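(* Let $\rho>0$ and $\mathrm{D}_{\varphi_1}=\mathrm{D}_{\varphi_2}=\rho\,\mathrm{KL}$. Let $p\in[1,+\infty)$, $\mathrm{C}_1(x,y)=|x-y|^p$ on $\mathbb{R}$, $\mathrm{C}_d(x,y)=\|x-y\|^p$ on $\mathbb{R}^d$. Let $\mathsf{X}\subset\mathbb{R}^d$ be compact, contained in the ball of radius $R>0$ centered at the origin, and let $(\alpha_n)_{n\ge1}$ be a sequence in $\mathcal{M}_+(\mathsf{X})$ and $\alpha\in\mathcal{M}_+(\mathsf{X})$. Then $$\alpha_n\rightharpoonup\alpha\iff\lim_{n\to\infty}\mathrm{SUOT}(\alpha_n,\alpha)=0\iff\lim_{n\to\infty}\mathrm{USOT}(\alpha_n,\alpha)=0.$$
   Context: $\alpha_n\rightharpoonup\alpha$ means $\int f\,d\alpha_n\to\int f\,d\alpha$ for every continuous $f:\mathbb{R}^d\to\mathbb{R}$. $\mathcal{M}_+(\mathsf{X})$: positive Radon measures supported in $\mathsf{X}$. For an entropy function $\varphi$, $\mathrm{D}_\varphi(\mu|\nu)=\int\varphi(\frac{d\mu}{d\nu})d\nu+\varphi'_\infty\mu^\perp(\mathbb{R}^s)$ ($\mu^\perp$ singular part of $\mu$ w.r.t. $\nu$, $\varphi'_\infty=\lim\varphi(x)/x$); $\rho\,\mathrm{KL}$ corresponds to $\varphi(x)=\rho(x\log x-x+1)$. $\mathrm{UOT}(\mu,\nu)=\inf_{\pi\ge0}\int C\,d\pi+\mathrm{D}_{\varphi_1}(\pi_1|\mu)+\mathrm{D}_{\varphi_2}(\pi_2|\nu)$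 with $\pi_1,\pi_2$ the marginals of $\pi$; on $\mathbb{R}$ the cost is $\mathrm{C}_1$. $\mathrm{OT}$ is balanced OT with cost $\mathrm{C}_1$ (value $+\infty$ if masses differ). With $\boldsymbol{\sigma}$ uniform on $\mathbb{S}^{d-1}$, $\theta^\star(x)=\langle\theta,x\rangle$: $\mathrm{SOT}(\alpha,\beta)=\int\mathrm{OT}(\theta^\star_\sharp\alpha,\theta^\star_\sharp\beta)d\boldsymbol{\sigma}$, $\mathrm{SUOT}(\alpha,\beta)=\int\mathrm{UOT}(\theta^\star_\sharp\alpha,\theta^\star_\sharp\beta)d\boldsymbol{\sigma}$, $\mathrm{USOT}(\alpha,\beta)=\inf_{\pi_1,\pi_2\in\mathcal{M}_+(\mathbb{R}^d)}\mathrm{SOT}(\pi_1,\pi_2)+\mathrm{D}_{\varphi_1}(\pi_1|\alpha)+\mathrm{D}_{\varphi_2}(\pi_2|\beta)$. *)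

(* Defs.v *)
From HB Require Import structures.
From mathcomp Require Import all_boot all_order all_algebra.
From mathcomp Require Import all_classical all_reals all_analysis.

Set Implicit Arguments.
Unset Strict Implicit.
Unset Printing Implicit Defensive.
Import Order.TTheory GRing.Theory Num.Theory.
Import numFieldNormedType.Exports.
Local Open Scope classical_set_scope.
Local Open Scope ring_scope.

Section sliced_uot.
Variable R : realType.

Definition Rd (d : nat) := g_sigma_algebraType (@open 'rV[R]_d).

Definition dotv d (u v : 'rV[R]_d) : R := \sum_(i < d) u 0 i * v 0 i.
Definition enorm d (x : 'rV[R]_d) : R := Num.sqrt (dotv x x).

Definition proj_theta d (theta : Rd d) : Rd d -> R := fun x => dotv theta x.

(* uniform probability measure on the unit sphere S^{d-1}: the probability
   measure carried by the sphere that is invariant under all orthogonal maps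
   (this characterises the normalised surface measure uniquely). *)
Definition uniform_sphere d (sigma : {measure set (Rd d) -> \bar R}) : Prop :=
  [/\ sigma setT = 1%E,
      sigma (~` [set x : Rd d | enorm x = 1]) = 0%E &
      forall M : 'M[R]_d, M *m M^T = 1%:M ->
        forall A : set (Rd d), measurable A ->
          sigma [set x : Rd d | A (x *m M)] = sigma A].

(* positive Radon measure supported in X: locally finite Borel measure on R^d
   (on R^d locally finite Borel measures are Radon) with alpha(R^d \ X) = 0 *)
Definition radon_in d (X : set 'rV[R]_d) (alpha : {measure set (Rd d) -> \bar R})
  : Prop :=
  (forall x : 'rV[R]_d, exists U : set 'rV[R]_d,
      [/\ open U, U x & (alpha U < +oo)%E]) /\
  alpha (~` X) = 0%E.

(* phi-divergence D_phi(mu|nu) = \int phi(dmu/dnu) dnu + phi'_oo mu^perp(T),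
   where mu = (dmu/dnu) nu + mu^perp is the Lebesgue decomposition of mu
   w.r.t. nu (expressed as the infimum over all such decompositions; it is
   unique, and the infimum of the empty set is +oo). *)
Definition Dphi dT (T : measurableType dT) (phi : R -> R) (phi_inf : \bar R)
    (mu nu : set T -> \bar R) : \bar R :=
  ereal_inf [set v | exists (f : T -> R) (ms : {measure set T -> \bar R}),
    [/\ measurable_fun setT f, (forall x, 0 <= f x),
      (exists N : set T, [/\ measurable N, nu N = 0%E & ms (~` N) = 0%E]),
      (forall A : set T, measurable A ->
        mu A = (\int[nu]_(x in A) (f x)%:E + ms A)%E) &
      v = (\int[nu]_x (phi (f x))%:E + phi_inf * ms setT)%E]].

Definition phiKL (rho : R) (x : R) : R := rho * (x * ln x - x + 1).
Definition KLdiv dT (T : measurableType dT) (rho : R) (mu nu : set T -> \bar R)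
  : \bar R := Dphi (phiKL rho) +oo%E mu nu.

Definition cost1 (p : R) (z : R * R) : R := `|z.1 - z.2| `^ p.

Definition OT (p : R) (mu nu : set R -> \bar R) : \bar R :=
  ereal_inf [set (\int[pi]_z (cost1 p z)%:E)%E |
    pi in [set pi : {measure set (R * R)%type -> \bar R} |
      forall A : set R, measurable A ->
        pushforward pi fst A = mu A /\ pushforward pi snd A = nu A]].

Definition UOT (p rho : R) (mu nu : set R -> \bar R) : \bar R :=
  ereal_inf [set (\int[pi]_z (cost1 p z)%:E
                  + KLdiv rho (pushforward pi fst) mu
                  + KLdiv rho (pushforward pi snd) nu)%E |
    pi in [set: {measure set (R * R)%type -> \bar R}]].

Definition SOT d (sigma : {measure set (Rd d) -> \bar R}) (p : R)
    (alpha beta : set (Rd d) -> \bar R) : \bar R :=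
  (\int[sigma]_theta OT p (pushforward alpha (proj_theta theta))
                          (pushforward beta (proj_theta theta)))%E.

Definition SUOT d (sigma : {measure set (Rd d) -> \bar R}) (p rho : R)
    (alpha beta : set (Rd d) -> \bar R) : \bar R :=
  (\int[sigma]_theta UOT p rho (pushforward alpha (proj_theta theta))
                               (pushforward beta (proj_theta theta)))%E.

Definition USOT d (sigma : {measure set (Rd d) -> \bar R}) (p rho : R)
    (alpha beta : set (Rd d) -> \bar R) : \bar R :=
  ereal_inf [set v | exists pi1 pi2 : {measure set (Rd d) -> \bar R},
    v = (SOT sigma p pi1 pi2 + KLdiv rho pi1 alpha + KLdiv rho pi2 beta)%E].

Definition weak_cvg d (alpha_ : nat -> {measure set (Rd d) -> \bar R})
    (alpha : {measure set (Rd d) -> \bar R}) : Prop :=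
  forall f : 'rV[R]_d -> R, continuous f ->
    (fun n => \int[alpha_ n]_x (f x)%:E)%E @ \oo
      --> (\int[alpha]_x (f x)%:E)%E.

End sliced_uot.

(* Main.v *)
(* Both functionals are compared with weak convergence directly.

   From weak convergence to the costs: take a continuous partition of unity
   (h_i) of X (for USOT), or of an interval containing all projections (for
   SUOT), subordinate to small balls, and let a_i, b_i be the masses of h_i
   under the two measures. The plan with density
   sum_i min(a_i, b_i) / (a_i b_i) h_i(x) h_i(y) w.r.t. the product measure
   only moves mass over small distances, and its marginals have densities at
   most 1 whose KL cost is at most rho * sum_i |a_i - b_i|; these masses
   converge by weak convergence.

   From the costs to weak convergence: if the cost is small then, for any ball
   around a point theta0 of the sphere, there is a direction theta in it with
   small one-dimensional cost, because sigma charges every such ball. Pinsker-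
   and Markov-type bounds turn this into closeness of the integrals of
   x |-> psi(<theta, x>) for psi Lipschitz, hence of x |-> psi(<theta0, x>).
   Applied to exponentials this gives convergence on the algebra spanned by
   x |-> exp(<theta, x>), which is uniformly dense in the continuous functions
   on X.

   The one-dimensional costs are not shown to be measurable in theta: the
   library integral of a nonnegative function is a lower integral, and only
   its monotonicity is used. *)
Require Import Defs.
From HB Require Import structures.
From mathcomp Require Import all_boot all_order all_algebra.
From mathcomp Require Import all_classical all_reals all_analysis.
From mathcomp Require Import measurable_realfun ring lra.
Import Order.TTheory GRing.Theory Num.Theory.
Import numFieldNormedType.Exports.
Local Open Scope classical_set_scope.
Local Open Scope ring_scope.
Set Implicit Arguments.
Unset Strict Implicit.
Unset Printing Implicit Defensive.

(** * Lower integrals, densities and image measures *)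

Section lower_integral.
Context d (T : measurableType d) (R : realType).
Variable mu : {measure set T -> \bar R}.
Local Open Scope ereal_scope.

(** Neither function is assumed measurable: a simple function below [f] is also below [g], so the
    supremum that defines the integral can only grow. *)
Lemma ge0_le_lower_integral (f g : T -> \bar R) :
  (forall x, 0 <= f x) -> (forall x, f x <= g x) ->
  \int[mu]_x f x <= \int[mu]_x g x.
Proof.
move=> f0 fg; rewrite !ge0_integralTE//; last first.
  by move=> x; exact: le_trans (f0 x) (fg x).
apply: ereal_sup_le => _ /= [h hf <-].
by exists h => // x; exact: le_trans (hf x) (fg x).
Qed.

End lower_integral.

Section density.
Context d (T : measurableType d) (R : realType).
Variable mu : {measure set T -> \bar R}.
Local Open Scope ereal_scope.
Import HBNNSimple.

(** Monotone convergence along simple approximations of [g] reduces the claim to indicators of level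
    sets, where it is the hypothesis on [nu]. *)
Lemma ge0_integral_density (nu : {measure set T -> \bar R}) (f : T -> R)
    (g : T -> \bar R) :
  measurable_fun setT f -> (forall x, 0 <= f x)%R ->
  (forall A, measurable A -> nu A = \int[mu]_(x in A) (f x)%:E) ->
  measurable_fun setT g -> (forall x, 0 <= g x) ->
  \int[nu]_x g x = \int[mu]_x (g x * (f x)%:E).
Proof.
move=> mf f0 nuE mg g0.
pose h := nnsfun_approx measurableT mg.
have mEf : measurable_fun setT (EFin \o f) by exact/measurable_EFinP.
have -> : \int[nu]_x g x =
    limn (fun n => \int[nu]_x (EFin \o h n) x).
  have gE x : g x = lim ((EFin \o h n) x @[n --> \oo]).
    by apply/esym/cvg_lim => //; exact: cvg_nnsfun_approx.
  under eq_integral => x _ do rewrite gE //.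
  apply: monotone_convergence => //.
  - by move=> n; apply/measurable_EFinP.
  - by move=> n x _; rewrite lee_fin.
  - by move=> x _ a b ab; rewrite lee_fin; exact/lefP/nd_nnsfun_approx.
have -> : \int[mu]_x (g x * (f x)%:E) =
    limn (fun n => \int[mu]_x ((EFin \o h n) x * (f x)%:E)).
  have fg x : g x * (f x)%:E = lim (((EFin \o h n) x * (f x)%:E) @[n --> \oo]).
    apply/esym/cvg_lim => //; apply: cvgeZr => //.
    exact: cvg_nnsfun_approx.
  under eq_integral => x _ do rewrite fg //.
  apply: monotone_convergence => //.
  - by move=> n; apply/emeasurable_funM => //; exact/measurable_EFinP.
  - by move=> n x _ /=; rewrite mule_ge0 ?lee_fin.
  - move=> x _ a b ab/=; rewrite lee_wpmul2r ?lee_fin//.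
    exact/lefP/nd_nnsfun_approx.
suff suf n : \int[mu]_x ((EFin \o h n) x * (f x)%:E) =
    \int[nu]_x (EFin \o h n) x.
  by under eq_fun do rewrite -suf.
transitivity (\int[nu]_x
   (\sum_(y \in range (h n)) (y * \1_(h n @^-1` [set y]) x)%:E)); last first.
  by apply: eq_integral => t tE; rewrite /= fimfunE -fsumEFin.
have indich m r : measurable_fun setT
    (fun x => (r * \1_(h m @^-1` [set r]) x)%:E).
  by apply: (measurable_comp measurableT) => //; exact: measurable_funM.
rewrite ge0_integral_fsum//; last by move=> m y Ey; exact: nnfun_muleindic_ge0.
transitivity (\int[mu]_x (\sum_(y \in range (h n))
    (y * \1_(h n @^-1` [set y]) x)%:E * (f x)%:E)).
  under [RHS]eq_integral => x xE.
    rewrite -ge0_mule_fsuml => [|y]; last exact: nnfun_muleindic_ge0.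
    rewrite fsumEFin // -(fimfunE _ x); over.
  by [].
rewrite ge0_integral_fsum//; last 2 first.
  - by move=> y; apply: emeasurable_funM.
  - by move=> m y _; rewrite mule_ge0 ?lee_fin// -lee_fin nnfun_muleindic_ge0.
apply: eq_fsbigr => r rhn.
under [RHS]eq_integral do rewrite EFinM.
rewrite integralZl_indic_nnsfun => //.
under eq_integral do rewrite EFinM -muleA.
rewrite ge0_integralZl//.
- under eq_integral do rewrite muleC.
  rewrite (eq_integral ((EFin \o f) \_ (h n @^-1` [set r]))); last first.
    by move=> x xE; rewrite epatch_indic.
  by rewrite -integral_mkcondr setTI -nuE// integral_indic// setIT.
- by apply: emeasurable_funM => //; exact/measurable_EFinP.
- by move=> t Et; rewrite mule_ge0 ?lee_fin.
- by move: rhn; rewrite inE => -[t _ <-]; rewrite lee_fin.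
Qed.

Lemma density_measure (f : T -> R) :
  measurable_fun setT f -> (forall x, 0 <= f x)%R ->
  exists nu : {measure set T -> \bar R},
    forall A, nu A = \int[mu]_(x in A) (f x)%:E.
Proof.
move=> mf f0.
pose m A := \int[mu]_(x in A) (f x)%:E.
have m0 : m set0 = 0 by rewrite /m integral_set0.
have m_ge0 A : 0 <= m A by apply: integral_ge0 => x _; rewrite lee_fin.
have m_add : semi_sigma_additive m.
  move=> F mF tF mUF; rewrite /m ge0_integral_bigcup//.
  - apply: is_cvg_ereal_nneg_natsum_cond => n _ _.
    by apply: integral_ge0 => x _; rewrite lee_fin.
  - by apply/measurable_funTS/measurable_EFinP.
  - by move=> x _; rewrite lee_fin.
pose mI := isMeasure.Build d T R m m0 m_ge0 m_add.
pose nu : {measure set T -> \bar R} := HB.pack m mI.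
by exists nu.
Qed.

End density.

(** The costs receive image measures as bare set functions; this provides a measure equal to them,
    so that integration theory applies. *)
Lemma pushforward_measure d1 d2 (T1 : measurableType d1)
    (T2 : measurableType d2) (R : realType) (mu : {measure set T1 -> \bar R})
    (f : T1 -> T2) : measurable_fun setT f ->
  exists nu : {measure set T2 -> \bar R}, (nu : set T2 -> \bar R) = pushforward mu f.
Proof.
move=> mf.
by exists (measure_function_pushforward__canonical__measure_function_Measure mu mf).
Qed.

Lemma fin_measure d (T : measurableType d) (R : realType)
    (mu : {measure set T -> \bar R}) : (mu setT < +oo)%E ->
  exists nu : {finite_measure set T -> \bar R},
    (nu : set T -> \bar R) = mu.
Proof.
case: mu => m c /lty_fin_num_fun mufin.
pose mu : {measure set T -> \bar R} := Measure.Pack c.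
pose mI := Measure_isFinite.Build d T R mu mufin.
pose nu : {finite_measure set T -> \bar R} := HB.pack (mu : set T -> \bar R) c mI.
by exists nu.
Qed.

(** * Scalar inequalities for the entropy function and for powers *)

Section phiKL_theory.
Context (R : realType).
Implicit Types rho x s : R.

(** From exp(-s) >= 1 - s one gets exp(s) <= 1 / (1 - s), and (1 - s)(1 + s + 2 s^2) = 1 + s^2 (1 -
    2 s) >= 1. *)
Lemma expR_le_quadratic s : s <= 2^-1 -> expR s <= 1 + s + 2 * s ^+ 2.
Proof.
move=> s2; have := expR_ge1Dx (- s); rewrite expRN => h.
have s1 : 0 < 1 - s by lra.
have : expR s <= (1 - s)^-1 by rewrite -[expR s]invrK lef_pV2// posrE invr_gt0 expR_gt0.
move=> /le_trans; apply.
rewrite -[leLHS]mul1r ler_pdivrMr//.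
have : 0 <= s ^+ 2 * (1 - 2 * s) by apply: mulr_ge0; [exact: sqr_ge0|lra].
by lra.
Qed.

(** Fenchel-Young inequality: exp(s) - 1 is the convex conjugate of x log x - x + 1. For x > 0 it is
    exp(u) >= 1 + u at u = s - log x, multiplied by x. *)
Lemma phiKL_young s x : 0 <= x -> x * s <= phiKL 1 x + expR s - 1.
Proof.
rewrite /phiKL le_eqVlt => /predU1P[<-|x0].
  by rewrite !mul0r; have := expR_ge0 s; lra.
have := expR_ge1Dx (s - ln x); rewrite expRB lnK// ler_pdivlMr//.
by lra.
Qed.

Lemma phiKLE rho x : phiKL rho x = rho * phiKL 1 x.
Proof. by rewrite /phiKL mul1r. Qed.

Lemma phiKL_ge0 rho x : 0 <= rho -> 0 <= x -> 0 <= phiKL rho x.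
Proof.
move=> rho0 x0; rewrite phiKLE mulr_ge0//.
by have := phiKL_young 0 x0; rewrite mulr0 expR0; lra.
Qed.

Lemma phiKL_le rho x : 0 <= rho -> 0 <= x <= 1 -> phiKL rho x <= rho * (1 - x).
Proof.
move=> rho0 /andP[x0 x1]; rewrite ler_wpM2l//.
have : x * ln x <= 0 by rewrite mulr_ge0_le0// ln_le0.
by lra.
Qed.

(** A Pinsker-type bound with an additive error. The Young inequality at [s] and at [- s], with the
    quadratic bound on exp, gives s |x - 1| <= phiKL 1 x + 2 s^2; dividing by [s] leaves the error 2
    s, at most [dl]. *)
Lemma norm_sub1_le_phiKL rho (dl : R) : 0 < rho -> 0 < dl ->
  exists2 K, 0 <= K & forall x, 0 <= x -> `|x - 1| <= dl + K * phiKL rho x.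
Proof.
move=> rho0 dl0; pose s := Num.min (dl / 2) 2^-1.
have s0 : 0 < s by rewrite lt_min; apply/andP; split; lra.
have sdl2 : s <= dl / 2 by rewrite ge_min lexx.
have sdl : 2 * s <= dl by lra.
have s2 : s <= 2^-1 by rewrite ge_min lexx orbT.
exists (rho * s)^-1 => [|x x0]; first by rewrite invr_ge0 mulr_ge0// ltW.
have -> : (rho * s)^-1 * phiKL rho x = phiKL 1 x / s.
  by rewrite phiKLE; field; rewrite !gt_eqF.
rewrite -(ler_pM2r s0) mulrDl divfK ?gt_eqF//.
have -> : `|x - 1| * s = `|(x - 1) * s| by rewrite normrM (gtr0_norm s0).
have h1 := phiKL_young s x0; have h2 := phiKL_young (- s) x0.
have h3 := expR_le_quadratic s2.
have h4 : expR (- s) <= 1 + - s + 2 * (- s) ^+ 2 by apply: expR_le_quadratic; lra.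
have h5 : 2 * s * s <= dl * s by rewrite ler_pM2r.
by rewrite ler_norml; apply/andP; split; lra.
Qed.

Lemma measurable_phiKL d (T : measurableType d) rho (f : T -> R) :
  measurable_fun setT f -> measurable_fun setT (phiKL rho \o f).
Proof.
move=> mf; apply: measurable_funM => //=; apply: measurable_funD => //.
apply: measurable_funB => //; apply: measurable_funM => //.
exact: measurableT_comp.
Qed.

(** Below [dl] the constant suffices. Above it t / dl >= 1, so t / dl <= (t / dl)^p; multiplying by
    [dl] gives the value of [K]. *)
Lemma le_powR_affine (p dl : R) : 1 <= p -> 0 < dl ->
  exists2 K, 0 <= K & forall t, 0 <= t -> t <= dl + K * t `^ p.
Proof.
move=> p1 dl0; exists (dl * dl^-1 `^ p) => [|t t0].
  by rewrite mulr_ge0 ?powR_ge0// ltW.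
have [tdl|dlt] := leP t dl.
  by apply: (le_trans tdl); rewrite lerDl !mulr_ge0 ?powR_ge0// ltW.
have dV0 : 0 <= dl^-1 by rewrite invr_ge0 ltW.
have -> : dl * dl^-1 `^ p * t `^ p = dl * (dl^-1 * t) `^ p by rewrite powRM// mulrA.
have h : dl^-1 * t <= (dl^-1 * t) `^ p.
  by apply: le1r_powR => //; rewrite mulrC ler_pdivlMr// mul1r ltW.
have : dl * (dl^-1 * t) <= dl * (dl^-1 * t) `^ p by rewrite ler_pM2l.
by rewrite mulrA mulfV ?gt_eqF// mul1r; lra.
Qed.

End phiKL_theory.

(** * KL divergence and absolute continuity *)

Section KLdiv_theory.
Context (R : realType) d (T : measurableType d).
Local Open Scope ereal_scope.

Lemma KLdiv_ge0 (rho : R) (mu : set T -> \bar R) (nu : {measure set T -> \bar R}) :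
  (0 <= rho)%R -> 0 <= KLdiv rho mu nu.
Proof.
move=> rho0; apply: le_ereal_inf_tmp => _ [f [ms [_ f0 _ _ ->]]].
apply: adde_ge0; last by rewrite mule_ge0.
by apply: integral_ge0 => x _; rewrite lee_fin phiKL_ge0.
Qed.

(** The recession slope is +oo, so a value below [e], being finite, leaves no singular part. *)
Lemma KLdiv_lt (rho : R) (mu : set T -> \bar R) (nu : {measure set T -> \bar R}) (e : \bar R) :
  (0 <= rho)%R -> KLdiv rho mu nu < e ->
  exists f : T -> R, [/\ measurable_fun setT f, (forall x, 0 <= f x)%R,
    (forall A, measurable A -> mu A = \int[nu]_(x in A) (f x)%:E) &
    \int[nu]_x (phiKL rho (f x))%:E < e].
Proof.
move=> rho0 /ereal_inf_lt[_ [f [ms [mf f0 _ muE ->]]] lte].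
have I0 : 0 <= \int[nu]_x (phiKL rho (f x))%:E.
  by apply: integral_ge0 => x _; rewrite lee_fin phiKL_ge0.
have ms0 : ms setT = 0.
  apply/eqP; rewrite eq_le measure_ge0 andbT leNgt; apply/negP => ms0.
  by move: lte; rewrite gt0_mulye// addey ?gt_eqF ?(lt_le_trans _ I0)// ltNge leey.
exists f; split => //.
  move=> A mA; rewrite muE//.
  suff -> : ms A = 0 by rewrite adde0.
  apply/eqP; rewrite eq_le measure_ge0 andbT -ms0.
  by apply: le_measure; rewrite ?inE.
by move: lte; rewrite ms0 mule0 adde0.
Qed.

Lemma KLdiv_le (rho : R) (mu : set T -> \bar R) (nu : {measure set T -> \bar R}) (f : T -> R) :
  measurable_fun setT f -> (forall x, 0 <= f x)%R ->
  (forall A, measurable A -> mu A = \int[nu]_(x in A) (f x)%:E) ->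
  KLdiv rho mu nu <= \int[nu]_x (phiKL rho (f x))%:E.
Proof.
move=> mf f0 muE; apply: ereal_inf_lbound; exists f, mzero; split => //.
- by exists set0.
- by move=> A mA; rewrite muE// adde0.
- by rewrite mule0 adde0.
Qed.

End KLdiv_theory.

(** * Effect of a reweighting of small divergence on integrals *)

Section stability.
Context (R : realType).
Local Open Scope ereal_scope.

Section density_bounds.
Context d (T : measurableType d) (rho : R) (mu P : {measure set T -> \bar R}) (f : T -> R).
Hypothesis rho0 : (0 <= rho)%R.
Hypothesis mf : measurable_fun setT f.
Hypothesis f0 : forall x, (0 <= f x)%R.
Hypothesis PE : forall A, measurable A -> P A = \int[mu]_(x in A) (f x)%:E.

Let meas_phi : measurable_fun setT (fun x => (phiKL rho (f x))%:E).
Proof. by apply/measurable_EFinP; exact: measurable_phiKL. Qed.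

Let phi0 x : 0 <= (phiKL rho (f x))%:E.
Proof. by rewrite lee_fin phiKL_ge0. Qed.

Lemma integral_le_density_phi (g h : T -> \bar R) (c k : R) : (0 <= c)%R -> (0 <= k)%R ->
  measurable_fun setT g -> measurable_fun setT h ->
  (forall x, 0 <= g x) -> (forall x, 0 <= h x) ->
  (forall x, g x <= h x + (c + k * phiKL rho (f x))%:E) ->
  \int[mu]_x g x <= \int[mu]_x h x +
    (c%:E * mu setT + k%:E * \int[mu]_x (phiKL rho (f x))%:E).
Proof.
move=> c0 k0 mg mh g0 h0 gh.
have m1 : measurable_fun setT (fun x => k%:E * (phiKL rho (f x))%:E).
  exact: measurable_funeM.
have -> : c%:E * mu setT + k%:E * \int[mu]_x (phiKL rho (f x))%:E =
    \int[mu]_x (c%:E + k%:E * (phiKL rho (f x))%:E).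
  rewrite ge0_integralD//=; last by move=> x _; rewrite mule_ge0.
  by rewrite integral_cst// ge0_integralZl.
rewrite -ge0_integralD//; last 2 first.
  by move=> x _; rewrite adde_ge0 ?mule_ge0.
  exact: emeasurable_funD.
apply: ge0_le_integral => //.
by apply: emeasurable_funD => //; exact: emeasurable_funD.
Qed.

Variables (M eta dl K B : R).
Hypotheses (muM : mu setT <= M%:E).
Hypothesis phi_eta : \int[mu]_x (phiKL rho (f x))%:E <= eta%:E.
Hypotheses (K0 : (0 <= K)%R) (dl0 : (0 <= dl)%R) (B0 : (0 <= B)%R).
Hypothesis phiP : forall x, (0 <= x -> `|x - 1| <= dl + K * phiKL rho x)%R.

Let phi_cst c k : (0 <= c)%R -> (0 <= k)%R ->
  c%:E * mu setT + k%:E * \int[mu]_x (phiKL rho (f x))%:E <= (c * M + k * eta)%:E.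
Proof.
by move=> c0 k0; rewrite EFinD !EFinM leeD// lee_wpmul2l.
Qed.

(** Pointwise g f <= g + B |f - 1|, and [phiP] bounds |f - 1|. The reverse estimate below starts
    from g <= g f + B |f - 1|. *)
Lemma density_integral_le (g : T -> R) : measurable_fun setT g ->
  (forall x, 0 <= g x <= B)%R ->
  \int[P]_x (g x)%:E <= \int[mu]_x (g x)%:E + (B * (dl * M + K * eta))%:E.
Proof.
move=> mg gB; have g0 x : (0 <= g x)%R by case/andP: (gB x).
rewrite (ge0_integral_density mf f0 PE)//; last exact/measurable_EFinP.
apply: le_trans.
  apply: (@integral_le_density_phi _ (EFin \o g) (B * dl) (B * K)); rewrite ?mulr_ge0//.
  - by apply: emeasurable_funM => //; exact/measurable_EFinP.
  - exact/measurable_EFinP.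
  - by move=> x; rewrite mule_ge0 ?lee_fin.
  move=> x; rewrite -EFinM -EFinD lee_fin.
  have /andP[_ gxB] := gB x.
  have h : (g x * `|f x - 1| <= B * (dl + K * phiKL rho (f x)))%R by rewrite ler_pM// phiP.
  have : (g x * (f x - 1) <= g x * `|f x - 1|)%R by rewrite ler_wpM2l// ler_norm.
  by lra.
rewrite leeD2l//; apply: le_trans; first by apply: phi_cst; rewrite mulr_ge0.
by rewrite lee_fin; lra.
Qed.

Lemma density_integral_ge (g : T -> R) : measurable_fun setT g ->
  (forall x, 0 <= g x <= B)%R ->
  \int[mu]_x (g x)%:E <= \int[P]_x (g x)%:E + (B * (dl * M + K * eta))%:E.
Proof.
move=> mg gB; have g0 x : (0 <= g x)%R by case/andP: (gB x).
rewrite (ge0_integral_density mf f0 PE)//; last exact/measurable_EFinP.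
apply: le_trans.
  apply: (@integral_le_density_phi (EFin \o g) (fun x => (g x)%:E * (f x)%:E)
    (B * dl) (B * K)); rewrite ?mulr_ge0//.
  - exact/measurable_EFinP.
  - by apply: emeasurable_funM => //; exact/measurable_EFinP.
  - by move=> x; rewrite mule_ge0 ?lee_fin.
  move=> x; rewrite -EFinM -EFinD lee_fin.
  have /andP[_ gxB] := gB x.
  have h : (g x * `|f x - 1| <= B * (dl + K * phiKL rho (f x)))%R by rewrite ler_pM// phiP.
  have : (- (g x * (f x - 1)) <= g x * `|f x - 1|)%R.
    by rewrite -mulrN ler_wpM2l// -normrN ler_norm.
  by lra.
rewrite leeD2l//; apply: le_trans; first by apply: phi_cst; rewrite mulr_ge0.
by rewrite lee_fin; lra.
Qed.

End density_bounds.

(* Unlike [density_integral_ge], no a priori bound on the mass of [mu] is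
   needed: it is controlled by the mass of [P]. *)
Lemma mass_le_density d (T : measurableType d) (rho : R)
    (mu P : {measure set T -> \bar R}) (f : T -> R) (K eta M : R) :
  (0 <= rho)%R -> measurable_fun setT f -> (forall x, 0 <= f x)%R ->
  (forall A, measurable A -> P A = \int[mu]_(x in A) (f x)%:E) ->
  \int[mu]_x (phiKL rho (f x))%:E <= eta%:E -> (0 <= K)%R ->
  (forall x, 0 <= x -> `|x - 1| <= 2^-1 + K * phiKL rho x)%R ->
  P setT <= M%:E ->
  mu setT <= (2 * M + 2 * K * eta)%:E.
Proof.
move=> rho0 mf f0 PE phi_eta K0 phiP PM.
have mEf : measurable_fun setT (EFin \o f) by exact/measurable_EFinP.
rewrite -[mu setT]mul1e -integral_cst//.
(* With error 1/2 the Pinsker-type bound reads 1 <= 2 f + 2 K phi(f); its constant is absorbed on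
   the left, so the mass of [mu] does not reappear on the right. *)
apply: le_trans.
  apply: (@integral_le_density_phi _ _ rho mu f rho0 mf f0 _
    (fun x => 2%:E * (f x)%:E) 0%R (2 * K)%R); rewrite ?mulr_ge0//.
  - exact: measurable_funeM.
  - by move=> x; rewrite mule_ge0 ?lee_fin.
  move=> x; rewrite -EFinM -EFinD lee_fin /=.
  have := phiP _ (f0 x); rewrite ler_norml => /andP[h _].
  by lra.
rewrite mul0e add0e ge0_integralZl//; last by move=> x _; rewrite lee_fin.
rewrite -PE// [leRHS]EFinD leeD//.
- by rewrite [leRHS]EFinM lee_wpmul2l ?lee_fin.
- by rewrite [leRHS]EFinM lee_wpmul2l// lee_fin mulr_ge0.
Qed.

End stability.

(** * Effect of a cheap transport plan on integrals *)

Section coupling_bounds.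
Context (R : realType).
Local Open Scope ereal_scope.

Lemma measurable_cost1 (p : R) : measurable_fun setT (cost1 p).
Proof.
have h : measurable_fun setT (fun z : R * R => `|z.1 - z.2|%R).
  by apply: measurableT_comp => //; exact: measurable_funB.
by rewrite /cost1; apply: (measurableT_comp (measurable_powR p) h).
Qed.

Lemma cost1_ge0 (p : R) z : (0 <= cost1 p z)%R.
Proof. exact: powR_ge0. Qed.

Lemma ge0_integral_marginal d1 d2 (T1 : measurableType d1) (T2 : measurableType d2)
    d (U : measurableType d) (m1 : {measure set T1 -> \bar R})
    (m2 : {measure set T2 -> \bar R}) (f1 : T1 -> U) (f2 : T2 -> U) (g : U -> \bar R) :
  measurable_fun setT f1 -> measurable_fun setT f2 ->
  (forall A, measurable A -> m1 (f1 @^-1` A) = m2 (f2 @^-1` A)) ->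
  measurable_fun setT g -> (forall x, 0 <= g x) ->
  \int[m1]_x g (f1 x) = \int[m2]_x g (f2 x).
Proof.
move=> mf1 mf2 m12 mg g0.
rewrite -[LHS](ge0_integral_pushforward mf1 m1 measurableT mg)//.
rewrite -[RHS](ge0_integral_pushforward mf2 m2 measurableT mg)//.
have [n1 n1E] := pushforward_measure m1 mf1.
have [n2 n2E] := pushforward_measure m2 mf2.
rewrite -n1E -n2E; apply: eq_measure_integral => A mA _.
by rewrite n1E n2E; exact: m12.
Qed.

(** The displacement |z.1 - z.2| is bounded affinely by the p-cost through [affP]: the constant is
    paid on the mass of [gam], the rest on its transport cost. *)
Lemma transport_integral_le (p L dl K M eta : R) (gam : {measure set (R * R)%type -> \bar R})
    (f g : R * R -> R) :
  (0 <= dl)%R -> (0 <= K)%R -> (0 <= L)%R ->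
  (forall t, 0 <= t -> t <= dl + K * t `^ p)%R ->
  measurable_fun setT f -> measurable_fun setT g ->
  (forall z, 0 <= f z)%R -> (forall z, 0 <= g z)%R ->
  (forall z, f z - g z <= L * `|z.1 - z.2|)%R ->
  gam setT <= M%:E -> \int[gam]_z (cost1 p z)%:E <= eta%:E ->
  \int[gam]_z (f z)%:E <= \int[gam]_z (g z)%:E + (L * (dl * M + K * eta))%:E.
Proof.
move=> dl0 K0 L0 affP mf mg f0 g0 fg gamM geta.
have mc : measurable_fun setT (fun z => (cost1 p z)%:E).
  by apply/measurable_EFinP; exact: measurable_cost1.
have c0 z : 0 <= (cost1 p z)%:E by rewrite lee_fin cost1_ge0.
have m1 : measurable_fun setT (fun z => (L * K)%:E * (cost1 p z)%:E).
  exact: measurable_funeM.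
have i0 z : 0 <= (L * K)%:E * (cost1 p z)%:E by rewrite mule_ge0// lee_fin mulr_ge0.
apply: (@le_trans _ _ (\int[gam]_z ((g z)%:E + ((L * dl)%:E + (L * K)%:E * (cost1 p z)%:E)))).
  apply: ge0_le_integral => //.
  - by move=> x _; rewrite lee_fin.
  - exact/measurable_EFinP.
  - by apply: emeasurable_funD; [exact/measurable_EFinP|exact: emeasurable_funD].
  - move=> z _; rewrite -EFinM -!EFinD lee_fin.
    have := fg z; have := affP `|z.1 - z.2|%R (normr_ge0 _).
    move=> /(ler_wpM2l L0); rewrite /cost1; lra.
rewrite ge0_integralD//; last 4 first.
  by move=> z _; rewrite lee_fin.
  exact/measurable_EFinP.
  by move=> z _; rewrite adde_ge0// lee_fin mulr_ge0.
  exact: emeasurable_funD.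
rewrite leeD2l// ge0_integralD//; last by move=> z _; rewrite lee_fin mulr_ge0.
rewrite integral_cst// ge0_integralZl//; last by rewrite lee_fin mulr_ge0.
rewrite mulrDr [leRHS]EFinD leeD//.
- by rewrite mulrA [leRHS]EFinM lee_wpmul2l// lee_fin mulr_ge0.
- by rewrite mulrA [leRHS]EFinM lee_wpmul2l// lee_fin mulr_ge0.
Qed.

Lemma Lipschitz_continuous (psi : R -> R) (L : R) :
  (forall x y, `|psi x - psi y| <= L * `|x - y|)%R -> continuous psi.
Proof.
move=> psiL x; apply/cvgrPdist_le => e e0.
near=> y; apply: (le_trans (psiL x y)).
have L1 : (0 < `|L| + 1)%R by rewrite ltr_wpDl.
have : (`|x - y| <= e / (`|L| + 1))%R.
  near: y; apply: cvgr_dist_le; first exact: cvg_id.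
  by rewrite divr_gt0.
rewrite ler_pdivlMr// => h; apply: le_trans h; rewrite mulrC ler_wpM2l//.
by rewrite (le_trans (ler_norm _))// lerDl.
Unshelve. all: by end_near. Qed.

Lemma Lipschitz_measurable (psi : R -> R) (L : R) :
  (forall x y, `|psi x - psi y| <= L * `|x - y|)%R -> measurable_fun setT psi.
Proof. by move=> /Lipschitz_continuous; exact: continuous_measurable_fun. Qed.

End coupling_bounds.

(** * Reweightings and transport combined *)

Section ridge_stability.
Context (R : realType) d (T : measurableType d).
Local Open Scope ereal_scope.

(** Both functionals lead to this situation: for [SUOT] the space is the real line and [u] the
    identity, for [USOT] it is R^d and [u] a projection. One stability estimate then serves both. *)
Definition near_coupling (rho p eta : R) (mu nu : {measure set T -> \bar R}) (u : T -> R) :=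
  exists (P1 P2 : {measure set T -> \bar R}) (gam : {measure set (R * R)%type -> \bar R}),
  [/\ KLdiv rho P1 mu < eta%:E, KLdiv rho P2 nu < eta%:E,
      (forall A, measurable A -> gam (fst @^-1` A) = P1 (u @^-1` A)),
      (forall A, measurable A -> gam (snd @^-1` A) = P2 (u @^-1` A)) &
      \int[gam]_z (cost1 p z)%:E < eta%:E].

(* The two reweightings and the transport each perturb the integral by
   [dl * C + eta * D], where only [D] depends on [dl]; hence [dl] is chosen
   first, then [eta]. *)
Lemma near_coupling_integral (rho p M B L eps : R) :
  (0 < rho)%R -> (1 <= p)%R -> (0 <= M)%R -> (0 <= B)%R -> (0 <= L)%R -> (0 < eps)%R ->
  exists2 eta, (0 < eta)%R &
  forall (mu nu : {measure set T -> \bar R}) (u : T -> R) (psi : R -> R),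
  measurable_fun setT u -> nu setT <= M%:E ->
  near_coupling rho p eta mu nu u ->
  (forall x, 0 <= psi x <= B)%R ->
  (forall x y, `|psi x - psi y| <= L * `|x - y|)%R ->
  \int[mu]_x (psi (u x))%:E <= \int[nu]_x (psi (u x))%:E + eps%:E /\
  \int[nu]_x (psi (u x))%:E <= \int[mu]_x (psi (u x))%:E + eps%:E.
Proof.
move=> rho0 p1 M0 B0 L0 eps0.
have [K1 K10 phi1] := norm_sub1_le_phiKL rho0 (@ltr01 R).
have [K2 K20 phi2] := @norm_sub1_le_phiKL R rho 2^-1 rho0 ltac:(lra).
(* [M1] will bound the common mass of [P2], [gam] and [P1], starting from that of [nu]; [M2] then
   bounds the mass of [mu], for which no bound is given. Both rely on eta <= 1. *)
pose M1 := (M + 1 * (1 * M + K1 * 1))%R.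
pose M2 := (2 * M1 + 2 * K2 * 1)%R.
have M10 : (0 <= M1)%R by rewrite /M1; lra.
have M20 : (0 <= M2)%R by rewrite /M2; lra.
pose C := (B * M2 + L * M1 + B * M + 1)%R.
have C0 : (0 < C)%R.
  by rewrite /C; have := mulr_ge0 B0 M20; have := mulr_ge0 L0 M10; have := mulr_ge0 B0 M0; lra.
pose dl := (eps / 2 / C)%R.
have dl0 : (0 < dl)%R by rewrite !divr_gt0.
have [K3 K30 phi3] := norm_sub1_le_phiKL rho0 dl0.
have [K4 K40 aff4] := le_powR_affine p1 dl0.
pose D := (B * K3 + L * K4 + B * K3 + 1)%R.
have D0 : (0 < D)%R.
  by rewrite /D; have := mulr_ge0 B0 K30; have := mulr_ge0 L0 K40; lra.
pose eta := Num.min 1%R (eps / 2 / D)%R.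
have eta0 : (0 < eta)%R by rewrite lt_min ltr01 !divr_gt0.
have eta1 : (eta <= 1)%R by rewrite ge_min lexx.
have etaD : (eta * D <= eps / 2)%R.
  by rewrite -ler_pdivlMr// ge_min lexx orbT.
have dlC : (dl * C = eps / 2)%R by rewrite /dl divfK ?gt_eqF.
exists eta => // mu nu u psi mu_ nuM [P1 [P2 [gam [KL1 KL2 g1 g2 cg]]]] psiB psiL.
have [f1 [mf1 f10 P1E phi_1]] := KLdiv_lt (ltW rho0) KL1.
have [f2 [mf2 f20 P2E phi_2]] := KLdiv_lt (ltW rho0) KL2.
have mpsi : measurable_fun setT psi := Lipschitz_measurable psiL.
have mpu : measurable_fun setT (psi \o u) by exact: measurableT_comp.
have psi0 x : (0 <= psi x)%R by case/andP: (psiB x).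
have psiuB x : (0 <= (psi \o u) x <= B)%R by exact: psiB.
have P2M : P2 setT <= M1%:E.
  have I1 (m : {measure set T -> \bar R}) : \int[m]_x (cst 1%R x)%:E = m setT.
    by have := integral_cst m measurableT 1; rewrite mul1e.
  have one x : (0 <= @cst T R 1 x <= 1)%R by rewrite /= ler01 lexx.
  have := density_integral_le (ltW rho0) mf2 f20 P2E nuM (ltW phi_2) K10 ler01 ler01 phi1
    (measurable_cst _) one.
  rewrite !I1 => h; apply: (le_trans h).
  by rewrite [leRHS]EFinD leeD// lee_fin !mul1r lerD2l ler_wpM2l.
have gamM : gam setT <= M1%:E by rewrite -(preimage_setT snd) g2.
have P1M : P1 setT <= M1%:E by rewrite -(preimage_setT u) -g1.
have muM : mu setT <= M2%:E.
  apply: le_trans; first exact: (mass_le_density (ltW rho0) mf1 f10 P1E (ltW phi_1) K20 phi2 P1M).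
  by rewrite lee_fin lerD2l ler_wpM2l// mulr_ge0.
have intP1 : \int[P1]_x (psi (u x))%:E = \int[gam]_z (psi z.1)%:E.
  apply/esym/(ge0_integral_marginal (g := fun x => (psi x)%:E)) => //.
  exact/measurable_EFinP.
have intP2 : \int[P2]_x (psi (u x))%:E = \int[gam]_z (psi z.2)%:E.
  apply/esym/(ge0_integral_marginal (g := fun x => (psi x)%:E)) => //.
  exact/measurable_EFinP.
have mpsi1 : measurable_fun setT (fun z : R * R => psi z.1) by exact: measurableT_comp.
have mpsi2 : measurable_fun setT (fun z : R * R => psi z.2) by exact: measurableT_comp.
have total : (B * (dl * M2 + K3 * eta) +
    (L * (dl * M1 + K4 * eta) + B * (dl * M + K3 * eta)) <= eps)%R.
  suff : (dl * C + eta * D <= eps)%R by rewrite /C /D; have := ltW dl0; have := ltW eta0; lra.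
  by lra.
(* Joins the three comparisons along [mu], [P1], [P2], [nu], and in the opposite order for the
   second inequality. *)
have chain (a b c e : \bar R) (x y z : R) : a <= b + x%:E -> b <= c + y%:E -> c <= e + z%:E ->
    (x + (y + z) <= eps)%R -> a <= e + eps%:E.
  move=> ab bc ce xyz; apply: (le_trans ab).
  apply: (@le_trans _ _ (c + y%:E + x%:E)); first by rewrite leeD2r.
  apply: (@le_trans _ _ (e + z%:E + y%:E + x%:E)); first by rewrite !leeD2r.
  by rewrite -!addeA leeD2l// -!EFinD lee_fin; lra.
have muP1 := density_integral_ge (ltW rho0) mf1 f10 P1E muM (ltW phi_1)
  K30 (ltW dl0) B0 phi3 mpu psiuB.
have P1mu := density_integral_le (ltW rho0) mf1 f10 P1E muM (ltW phi_1)
  K30 (ltW dl0) B0 phi3 mpu psiuB.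
have nuP2 := density_integral_ge (ltW rho0) mf2 f20 P2E nuM (ltW phi_2)
  K30 (ltW dl0) B0 phi3 mpu psiuB.
have P2nu := density_integral_le (ltW rho0) mf2 f20 P2E nuM (ltW phi_2)
  K30 (ltW dl0) B0 phi3 mpu psiuB.
have psi12 z : (psi z.1 - psi z.2 <= L * `|z.1 - z.2|)%R.
  by apply: le_trans (psiL _ _); exact: ler_norm.
have psi21 z : (psi z.2 - psi z.1 <= L * `|z.1 - z.2|)%R.
  by apply: le_trans (psiL _ _); rewrite distrC; exact: ler_norm.
have g12 := transport_integral_le (ltW dl0) K40 L0 aff4 mpsi1 mpsi2
  (fun=> psi0 _) (fun=> psi0 _) psi12 gamM (ltW cg).
have g21 := transport_integral_le (ltW dl0) K40 L0 aff4 mpsi2 mpsi1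
  (fun=> psi0 _) (fun=> psi0 _) psi21 gamM (ltW cg).
split.
- by apply: chain muP1 _ P2nu total; rewrite [leLHS]intP1 [in leRHS]intP2.
- apply: chain nuP2 _ P1mu _; first by rewrite [leLHS]intP2 [in leRHS]intP1; exact: g21.
  by rewrite addrCA; move: total; lra.
Qed.

End ridge_stability.

(** * Finite nets and the Euclidean geometry of row vectors *)

Lemma compact_finite_net (R : realType) (V : normedModType R) (X : set V) (r : R) :
  compact X -> 0 < r ->
  exists s : seq V, (forall y, y \in s -> X y) /\
    forall x, X x -> exists2 y, y \in s & `|x - y| < r.
Proof.
rewrite compact_cover => Xc r0.
have [D' DX XD] : finite_subset_cover X (fun y : V => ball y r) X.
  apply: Xc; first by move=> y _; exact: ball_open.
  by move=> x Xx; exists x => //; exact: ballxx.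
exists (finmap.enum_fset D'); split => [y yD|x /XD[y /= yD]]; first exact: set_mem (DX y yD).
by rewrite -ball_normE /= distrC => xy; exists y.
Qed.

Lemma cvg_sumr (R : numFieldType) (T : Type) (F : set_system T) {FF : Filter F}
    (I : Type) (s : seq I) (f : I -> T -> R) (l : I -> R) :
  (forall i, f i x @[x --> F] --> l i) ->
  \sum_(i <- s) f i x @[x --> F] --> \sum_(i <- s) l i.
Proof.
move=> fl; elim: s => [|i s IH].
  by rewrite big_nil; under eq_fun do rewrite big_nil; exact: cvg_cst.
by rewrite big_cons; under eq_fun do rewrite big_cons; exact: cvgD (fl i) IH.
Qed.

Section dotv_theory.
Context (R : realType) (d : nat).
Implicit Types u v w : 'rV[R]_d.

Lemma dotvE u v : dotv u v = (u *m v^T) 0 0.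
Proof. by rewrite mxE; apply: eq_bigr => i _; rewrite mxE. Qed.

Lemma dotvC u v : dotv u v = dotv v u.
Proof. by apply: eq_bigr => i _; rewrite mulrC. Qed.

Lemma dotvDl u v w : dotv (u + v) w = dotv u w + dotv v w.
Proof. by rewrite /dotv -big_split; apply: eq_bigr => i _; rewrite mxE mulrDl. Qed.

Lemma dotvNl u w : dotv (- u) w = - dotv u w.
Proof. by rewrite /dotv -sumrN; apply: eq_bigr => i _; rewrite mxE mulNr. Qed.

Lemma dotvZl a u w : dotv (a *: u) w = a * dotv u w.
Proof. by rewrite /dotv mulr_sumr; apply: eq_bigr => i _; rewrite mxE mulrA. Qed.

Lemma dotvBl u v w : dotv (u - v) w = dotv u w - dotv v w.
Proof. by rewrite dotvDl dotvNl. Qed.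

Lemma dotvBr u v w : dotv w (u - v) = dotv w u - dotv w v.
Proof. by rewrite dotvC dotvBl !(dotvC _ w). Qed.

Lemma dotvv_ge0 u : 0 <= dotv u u.
Proof. by apply: sumr_ge0 => i _; rewrite -expr2 sqr_ge0. Qed.

Lemma le_coord_norm u i : `|u 0 i| <= `|u|.
Proof. by rewrite {2}/Num.norm/= mx_normrE; exact: (le_bigmax _ _ (0, i)). Qed.

(** On row vectors [|u|] is the maximum of the coordinates, not the Euclidean norm, hence the factor
    [d]. *)
Lemma norm_dotv_le u v : `|dotv u v| <= d%:R * (`|u| * `|v|).
Proof.
apply: (le_trans (ler_norm_sum _ _ _)).
apply: (@le_trans _ _ (\sum_(i < d) `|u| * `|v|)).
  by apply: ler_sum => i _; rewrite normrM ler_pM// le_coord_norm.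
by rewrite sumr_const card_ord -[leLHS]mulr_natl.
Qed.

Lemma sqr_norm_le_dotv u : `|u| ^+ 2 <= dotv u u.
Proof.
have [u0|u0] := eqVneq `|u| 0; first by rewrite u0 expr0n dotvv_ge0.
have [[i j]] := mx_norm_neq0 u0; rewrite (ord1 i) /= -[mx_norm u]/(Num.norm u) => uE.
rewrite uE /dotv (bigD1 j)//= -normrX ger0_norm ?sqr_ge0// expr2 lerDl.
by apply: sumr_ge0 => k _; rewrite -expr2 sqr_ge0.
Qed.

Lemma enorm1 u : (enorm u = 1) <-> (dotv u u = 1).
Proof.
split; last by rewrite /enorm => ->; rewrite sqrtr1.
by move=> h; rewrite -(sqr_sqrtr (dotvv_ge0 u)) -/(enorm u) h expr1n.
Qed.

Lemma enorm1_norm_le u : enorm u = 1 -> `|u| <= 1.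
Proof.
move/enorm1 => u1; rewrite -(@ler_pXn2r _ 2) ?nnegrE// expr1n -u1.
exact: sqr_norm_le_dotv.
Qed.

Lemma continuous_dotv u : continuous (dotv u).
Proof.
move=> v; apply: (@cvg_sumr _ _ (nbhs v)) => i.
by apply: cvgM; [exact: cvg_cst|exact: coord_continuous].
Qed.

Lemma continuous_dotvv : continuous (fun v : 'rV[R]_d => dotv v v).
Proof.
move=> v; apply: (@cvg_sumr _ _ (nbhs v)) => i.
by apply: cvgM; exact: coord_continuous.
Qed.

Lemma continuous_dotvv_sub u : continuous (fun v : 'rV[R]_d => dotv (v - u) (v - u)).
Proof.
move=> v; have h : x - u @[x --> v] --> v - u.
  by apply: (@cvgB _ _ _ (nbhs v)); [exact: cvg_id|exact: cvg_cst].
exact: (cvg_comp _ _ h (@continuous_dotvv (v - u))).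
Qed.

(** The witness is the reflection in the hyperplane orthogonal to w = u - v, which exchanges two
    unit vectors. Orthogonal maps thus act transitively on the sphere. *)
Lemma householder u v : dotv u u = 1 -> dotv v v = 1 ->
  exists2 M : 'M[R]_d, M *m M^T = 1%:M & u *m M = v.
Proof.
move=> u1 v1; have [<-|uv] := eqVneq u v.
  by exists 1%:M; rewrite ?trmx1 ?mulmx1.
pose w := u - v; pose q := dotv w w.
have q0 : q != 0.
  apply: contra uv => /eqP q0; rewrite -subr_eq0 -normr_le0 -/w.
  have := sqr_norm_le_dotv w; rewrite -/q q0.
  by rewrite -[leRHS](expr0n R 2) ler_pXn2r ?nnegrE//.
have qE : q = 2 * (1 - dotv u v).
  by rewrite /q /w dotvBl !dotvBr u1 v1 (dotvC v u); ring.
have wwE : w *m w^T = q%:M.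
  by apply/rowP => i; rewrite (ord1 i) -dotvE mxE eqxx mulr1n.
have uwE : u *m w^T = (q / 2)%:M.
  apply/rowP => i; rewrite (ord1 i) -dotvE mxE eqxx mulr1n qE /w dotvBr u1.
  by rewrite mulrAC mulfV ?mul1r// pnatr_eq0.
pose A := w^T *m w.
have AA : A *m A = q *: A.
  by rewrite /A mulmxA -(mulmxA w^T) wwE mul_mx_scalar scalemxAl.
have AT : A^T = A by rewrite /A trmx_mul trmxK.
exists (1%:M - (2 / q) *: A).
  have -> : (1%:M - (2 / q) *: A)^T = 1%:M - (2 / q) *: A.
    by apply/matrixP => i j; rewrite -[in RHS]AT !mxE eq_sym.
  rewrite mulmxBl !mulmxBr !mul1mx !mulmx1 -scalemxAl -scalemxAr AA !scalerA.
  have -> : 2 / q * (2 / q) * q = 2 / q + 2 / q by field.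
  by rewrite scalerDl opprB addrK subrK.
rewrite mulmxBr mulmx1 -scalemxAr /A mulmxA uwE mul_scalar_mx scalerA.
have -> : 2 / q * (q / 2) = 1 by field.
by rewrite scale1r /w opprB addrC subrK.
Qed.

End dotv_theory.

(** * Borel structure of R^d and the uniform measure on the sphere *)

Section Rd_measurability.
Context (R : realType) (d : nat).

Lemma open_measurable_Rd (A : set 'rV[R]_d) : open A -> measurable (A : set (Rd R d)).
Proof. by move=> oA; exact: sub_sigma_algebra. Qed.

Lemma closed_measurable_Rd (A : set 'rV[R]_d) : closed A -> measurable (A : set (Rd R d)).
Proof.
move=> cA; rewrite -[A]setCK; apply: measurableC.
by apply: open_measurable_Rd; exact: closed_openC.
Qed.

Lemma continuous_measurable_Rd (f : 'rV[R]_d -> R) :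
  continuous f -> measurable_fun [set: Rd R d] (f : Rd R d -> R).
Proof.
move=> /continuousP cf; apply: (measurability _ (RGenOpens.measurableE R)).
move=> _ [_ [a [b ->] <-]]; rewrite setTI.
by apply: open_measurable_Rd; apply: cf; exact: interval_open.
Qed.

Lemma closed_sphere : closed [set x : 'rV[R]_d | enorm x = 1].
Proof.
have -> : [set x | enorm x = 1] = (fun v : 'rV[R]_d => dotv v v) @^-1` [set 1].
  by apply/seteqP; split => x /enorm1.
by apply: closed_comp => [x _|]; [exact: continuous_dotvv|exact: closed_eq].
Qed.

Lemma measurable_norm_ball (theta : 'rV[R]_d) (r : R) :
  measurable ([set x | `|x - theta| < r] : set (Rd R d)).
Proof.
apply: open_measurable_Rd.
have -> : [set x : 'rV[R]_d | `|x - theta| < r] = ball theta r.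
  by apply/seteqP; split => x; rewrite -ball_normE /= distrC.
exact: ball_open.
Qed.

Lemma measurable_proj_theta (theta : Rd R d) :
  measurable_fun [set: Rd R d] (proj_theta theta).
Proof. by apply: continuous_measurable_Rd; exact: continuous_dotv. Qed.

Lemma measurable_dotv : measurable_fun [set: Rd R d * Rd R d]
  (fun z : Rd R d * Rd R d => dotv z.1 z.2).
Proof.
have mc i : measurable_fun [set: Rd R d] (fun x : Rd R d => x 0 i).
  by apply: continuous_measurable_Rd; exact: coord_continuous.
apply: measurable_sum => i; apply: measurable_funM.
- exact: (measurableT_comp (mc i) measurable_fst).
- exact: (measurableT_comp (mc i) measurable_snd).
Qed.

(** If the ball were null, invariance under reflections would make every ball of this Euclidean
    radius centred on the sphere null. Finitely many of them cover the compact sphere, which carries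
    mass 1. *)
Lemma uniform_sphere_ball_gt0 (sigma : {measure set (Rd R d) -> \bar R})
    (theta : 'rV[R]_d) (r : R) :
  uniform_sphere sigma -> enorm theta = 1 -> 0 < r ->
  (0 < sigma [set x | (`|x - theta| < r)%R])%E.
Proof.
move=> [sT sC sM] th1 r0.
(* Euclidean balls are used because orthogonal maps preserve [dotv] but not the sup norm. *)
pose E (y : 'rV[R]_d) : set (Rd R d) := [set x | dotv (x - y) (x - y) < r ^+ 2].
pose S : set (Rd R d) := [set x : Rd R d | enorm x = 1].
have oE y : open (E y : set 'rV[R]_d).
  apply: (@open_comp _ _ (fun x : 'rV[R]_d => dotv (x - y) (x - y)) [set t | t < r ^+ 2]).
    move=> x _; exact: continuous_dotvv_sub.
  exact: open_lt.
have mE y : measurable (E y) by apply: open_measurable_Rd; exact: oE.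
have mB := measurable_norm_ball theta r.
rewrite lt0e measure_ge0 andbT; apply/eqP => sB.
have sEth : sigma (E theta) = 0%E.
  apply/eqP; rewrite eq_le measure_ge0 andbT -sB.
  apply: le_measure; [exact: mem_set (mE _)|exact: mem_set mB|].
  move=> x /= xE; rewrite -(@ltr_pXn2r _ 2) ?nnegrE ?(ltW r0)//.
  exact: le_lt_trans (sqr_norm_le_dotv _) xE.
have sE y : enorm y = 1 -> sigma (E y) = 0%E.
  move=> y1; have [M MM yM] := householder ((enorm1 theta).1 th1) ((enorm1 y).1 y1).
  rewrite -(sM M MM)// -sEth; congr (sigma _); apply/seteqP; split => x /=;
  by rewrite /E /= -yM -mulmxBl !dotvE trmx_mul mulmxA -(mulmxA _ M) MM mulmx1.
have cS : closed (S : set 'rV[R]_d) := closed_sphere.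
have compS : compact (S : set 'rV[R]_d).
  apply: bounded_closed_compact => //.
  exists 1; split => // t t1 x /enorm1_norm_le /le_trans; apply; exact: ltW.
(* The net is taken in the sup norm: at sup distance below r' the squared Euclidean distance is at
   most d r'^2 < r^2. *)
pose r' := r / (d%:R + 1).
have d1 : (0 : R) < d%:R + 1 by rewrite ltr_wpDl.
have r'0 : 0 < r' by rewrite divr_gt0.
have [s [sS sP]] := compact_finite_net compS r'0.
pose U (t : seq 'rV[R]_d) : set (Rd R d) := [set x | exists2 y, y \in t & S y /\ E y x].
have U0 t : sigma.-negligible (U t).
  elim: t => [|y t IH]; first by apply: negligibleS (negligible_set0 _) => x [].
  have [Sy|nSy] := pselect (S y).
    have nE : sigma.-negligible (E y) by apply/negligibleP => //; exact: sE.
    apply: negligibleS (negligibleU nE IH) => x [z].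
    by rewrite inE => /predU1P[->|zt] [Sz Ez]; [left|right; exists z].
  apply: negligibleS IH => x [z].
  by rewrite inE => /predU1P[->|zt] [Sz Ez]; [|exists z].
have SU : S `<=` U s.
  move=> x /sP[y ys xy]; exists y => //; split; first exact: sS.
  rewrite /E /=; apply: (@le_lt_trans _ _ (d%:R * (`|x - y| * `|x - y|))).
    by apply: le_trans (norm_dotv_le _ _); exact: ler_norm.
  have rE : r = (d%:R + 1) * r' by rewrite /r' mulrC divfK ?gt_eqF.
  have d0 : (0 : R) <= d%:R by [].
  have h1 : `|x - y| * `|x - y| <= r' * r' by rewrite ler_pM// ltW.
  have h2 : d%:R * (`|x - y| * `|x - y|) <= d%:R * (r' * r') by rewrite ler_wpM2l.
  apply: (le_lt_trans h2); rewrite rE exprMn expr2 (expr2 r') ltr_pM2r ?mulr_gt0//.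
  by have := mulr_ge0 d0 d0; lra.
have mS : measurable S by exact: closed_measurable_Rd.
have nS : sigma.-negligible S by exact: negligibleS SU (U0 s).
have sS0 : sigma S = 0%E by apply/negligibleP.
have : sigma (S `|` ~` S) = 0%E.
  apply/eqP; rewrite eq_le measure_ge0 andbT.
  have e : (sigma S + sigma (~` S) <= 0)%E by rewrite sS0 sC adde0.
  exact: (le_trans (measureU2 _ mS (measurableC mS)) e).
by rewrite setUv sT => /eqP; rewrite onee_eq0.
Qed.

End Rd_measurability.

(** * Continuous functions on a compact set *)

Section continuous_compact.
Context (R : realType) (V : normedModType R) (X : set V) (f : V -> R).
Hypotheses (Xc : compact X) (cf : continuous f).

Lemma compact_uniform_modulus (e : R) : 0 < e ->
  exists2 r, 0 < r & forall x y, X x -> `|x - y| < r -> `|f x - f y| < e.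
Proof.
move=> e0; have e20 : 0 < e / 2 by rewrite divr_gt0.
pose P r x := forall y, `|x - y| < r -> `|f x - f y| < e.
have nP : \forall r \near (0 : R)^'+, X `<=` P r.
  apply: ((compact_near_coveringP X).1 Xc) => x Xx.
  have /cvgrPdist_lt/(_ _ e20)/nbhs_ballP[r /= r0 rP] := @cf x.
  have r20 : 0 < r / 2 by rewrite divr_gt0.
  exists (ball x (r / 2), [set t | t < r / 2]).
    by split; [exact: nbhsx_ballx|exact: nbhs_right_lt].
  move=> [x' t] /= [xx' tr] y x'y.
  rewrite -ball_normE /= in xx'.
  have h1 : `|f x - f x'| < e / 2.
    by apply: rP; rewrite -ball_normE /=; lra.
  have h2 : `|f x - f y| < e / 2.
    apply: rP; rewrite -ball_normE /=.
    by have := ler_distD x' x y; lra.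
  by have := ler_distD (f x) (f x') (f y); rewrite (distrC (f x') (f x)); lra.
have [r [rP r0]] := filter_ex (filterI nP (nbhs_right_gt 0)).
by exists r => // x y Xx; exact: rP.
Qed.

Lemma compact_continuous_bound : exists2 M, 0 < M & forall x, X x -> `|f x| <= M.
Proof.
have : bounded_set (f @` X : set R^o).
  by apply/compact_bounded/continuous_compact => //; exact: continuous_subspaceT.
move=> [M [_ MP]].
exists (`|M| + 1); first by rewrite ltr_wpDl.
move=> x Xx; apply: MP; last by exists x.
by rewrite (le_lt_trans (ler_norm _))// ltrDl.
Qed.

End continuous_compact.

Lemma compact_norm_bound (R : realType) (V : normedModType R) (X : set V) :
  compact X -> exists2 C, 0 < C & forall x, X x -> `|x| <= C.
Proof.
move=> Xc; have [M [_ MP]] := compact_bounded Xc.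
exists (`|M| + 1); first by rewrite ltr_wpDl.
by move=> x Xx; apply: MP => //; rewrite (le_lt_trans (ler_norm _))// ltrDl.
Qed.

(** * Lattice operations in the uniform closure of an algebra of functions *)

Section uniform_closure.
Context (R : realType) (V : Type) (X : set V).

Definition uclosure (E : (V -> R) -> Prop) (f : V -> R) :=
  forall e, 0 < e -> exists2 g, E g & forall x, X x -> `|f x - g x| <= e.

Variable E : (V -> R) -> Prop.
Hypothesis Ecst : forall c, E (fun=> c).
Hypothesis ED : forall f g, E f -> E g -> E (fun x => f x + g x).
Hypothesis EM : forall f g, E f -> E g -> E (fun x => f x * g x).
Hypothesis Ebnd : forall f, E f -> exists2 M, 0 < M & forall x, X x -> `|f x| <= M.

Local Notation cl := (uclosure E).

Lemma ucl_sub f : E f -> cl f.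
Proof. by move=> Ef e e0; exists f => // x _; rewrite subrr normr0 ltW. Qed.

Lemma ucl_bnd f : cl f -> exists2 M, 0 < M & forall x, X x -> `|f x| <= M.
Proof.
move=> /(_ _ ltr01)[g /Ebnd[M M0 gM] fg]; exists (M + 1); first by rewrite addr_gt0.
move=> x Xx; have := gM _ Xx; have := fg _ Xx.
have := ler_normD (f x - g x) (g x); rewrite subrK; lra.
Qed.

Lemma uclD f g : cl f -> cl g -> cl (fun x => f x + g x).
Proof.
move=> cf cg e e0; have e20 : 0 < e / 2 by rewrite divr_gt0.
have [f' Ef' ff'] := cf _ e20; have [g' Eg' gg'] := cg _ e20.
exists (fun x => f' x + g' x); first exact: ED.
move=> x Xx; rewrite opprD addrACA.
by have := ler_normD (f x - f' x) (g x - g' x); have := ff' _ Xx; have := gg' _ Xx; lra.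
Qed.

Lemma uclM f g : cl f -> cl g -> cl (fun x => f x * g x).
Proof.
move=> cf cg e e0.
have [Mg Mg0 gM] := ucl_bnd cg.
pose e1 := e / 2 / Mg; have e10 : 0 < e1 by rewrite !divr_gt0.
have [f' Ef' ff'] := cf _ e10.
have [Mf Mf0 fM] := Ebnd Ef'.
(* The tolerance for [g] is chosen after f', because it depends on the bound of f'. *)
pose e2 := e / 2 / Mf; have e20 : 0 < e2 by rewrite !divr_gt0.
have [g' Eg' gg'] := cg _ e20.
exists (fun x => f' x * g' x); first exact: EM.
move=> x Xx.
have -> : f x * g x - f' x * g' x = (f x - f' x) * g x + f' x * (g x - g' x) by ring.
apply: (le_trans (ler_normD _ _)); rewrite !normrM.
have h1 : `|f x - f' x| * `|g x| <= e1 * Mg by apply: ler_pM => //; [exact: ff'|exact: gM].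
have h2 : `|f' x| * `|g x - g' x| <= Mf * e2 by apply: ler_pM => //; [exact: fM|exact: gg'].
have E1 : e1 * Mg = e / 2 by rewrite /e1 divfK ?gt_eqF.
have E2 : Mf * e2 = e / 2 by rewrite /e2 mulrC divfK ?gt_eqF.
by lra.
Qed.

Lemma ucl_cst c : cl (fun=> c).
Proof. exact/ucl_sub/Ecst. Qed.

Lemma uclZ c f : cl f -> cl (fun x => c * f x).
Proof. by move=> cf; apply: uclM => //; exact: ucl_cst. Qed.

Lemma uclB f g : cl f -> cl g -> cl (fun x => f x - g x).
Proof.
move=> cf cg; have := uclD cf (uclZ (-1) cg).
by under [X in cl X -> _]eq_fun do rewrite mulN1r.
Qed.

Lemma ucl_closed f :
  (forall e, 0 < e -> exists2 g, cl g & forall x, X x -> `|f x - g x| <= e) -> cl f.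
Proof.
move=> H e e0; have e20 : 0 < e / 2 by rewrite divr_gt0.
have [g cg fg] := H _ e20; have [h Eh gh] := cg _ e20.
exists h => // x Xx.
by have := ler_distD (g x) (f x) (h x); have := fg _ Xx; have := gh _ Xx; lra.
Qed.

(* The classical iteration p(k+1) = p(k) + (t^2 - p(k)^2) / 2 converging to |t|. *)
Fixpoint abs_iter (k : nat) (t : R) : R :=
  if k is k'.+1 then abs_iter k' t + (t * t - abs_iter k' t * abs_iter k' t) / 2 else 0.

(** The error D(k) = |t| - p(k) satisfies D(k+1) = D(k) (1 - (|t| + p(k)) / 2), and (1 - |t|/2)(1 +
    (k+1)|t|/2) <= 1 + k |t|/2. So D(k) (1 + k |t|/2) never exceeds its initial value |t|, and D(k)
    <= 2 / k uniformly in [t]. *)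
Lemma abs_iterP k t : `|t| <= 1 ->
  [/\ 0 <= abs_iter k t, abs_iter k t <= `|t| &
      (`|t| - abs_iter k t) * (1 + k%:R * (`|t| / 2)) <= `|t|].
Proof.
move=> t1; have tt : t * t = `|t| * `|t| by rewrite -normrM ger0_norm// -expr2 sqr_ge0.
have t0 : 0 <= `|t| by [].
elim: k => [|k [p0 pt IH]] /=; first by rewrite subr0 mul0r addr0 mulr1.
set p := abs_iter k t in p0 pt IH *; set s := `|t| in t1 tt t0 p0 pt IH *.
have h : s - (p + (t * t - p * p) / 2) = (s - p) * (1 - (s + p) / 2) by rewrite tt; field.
have sp0 : 0 <= s - p by rewrite subr_ge0.
have h1 : 0 <= (s - p) * (1 - (s + p) / 2) by apply: mulr_ge0 => //; lra.
have h2 : 0 <= (s - p) * (s + p) by apply: mulr_ge0 => //; rewrite addr_ge0.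
split.
- have -> : t * t - p * p = (s - p) * (s + p) by rewrite tt; ring.
  by rewrite addr_ge0 ?divr_ge0.
- by rewrite -subr_ge0 h.
rewrite h; apply: le_trans IH.
have k0 : (0 : R) <= k%:R by [].
have h3 : 0 <= p * (1 + k.+1%:R * (s / 2)).
  by rewrite mulr_ge0// addr_ge0// mulr_ge0// divr_ge0.
have h4 : 0 <= k.+1%:R * s * s by rewrite !mulr_ge0.
have h5 : 0 <= (s - p) * (p * (1 + k.+1%:R * (s / 2))) by rewrite mulr_ge0.
have h6 : 0 <= (s - p) * (k.+1%:R * s * s) by rewrite mulr_ge0.
by rewrite -natr1 in h5 h6 *; lra.
Qed.

Lemma ucl_abs_iter k f : cl f -> cl (fun x => abs_iter k (f x)).
Proof.
move=> cf; elim: k => [|k IH] /=; first exact: ucl_cst.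
apply: uclD => //.
have := uclZ 2^-1 (uclB (uclM cf cf) (uclM IH IH)).
by under [X in cl X -> _]eq_fun do rewrite mulrC.
Qed.

Lemma ucl_abs f : cl f -> cl (fun x => `|f x|).
Proof.
move=> cf; have [M M0 fM] := ucl_bnd cf.
apply: ucl_closed => e e0.
(* Dividing by [M] brings the values of [f] into [-1, 1]; after rescaling, the error of the
   iteration is at most 2 M / k, to be kept below [e]. *)
pose k := Num.bound (2 * M / e).
exists (fun x => M * abs_iter k.+1 (M^-1 * f x)).
  by apply: uclZ; apply: (@ucl_abs_iter k.+1 (fun x => M^-1 * f x)); exact: uclZ.
move=> x Xx; set t := M^-1 * f x.
have t1 : `|t| <= 1.
  by rewrite normrM gtr0_norm ?invr_gt0// mulrC ler_pdivrMr// mul1r fM.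
have [p0 pt pk] := abs_iterP k.+1 t1.
have fE : `|f x| = M * `|t|.
  by rewrite /t normrM gtr0_norm ?invr_gt0// mulrA mulfV ?gt_eqF// mul1r.
rewrite fE -mulrBr normrM (gtr0_norm M0) ger0_norm ?subr_ge0//.
set D := _ - _ in pk *.
have D0 : 0 <= D by rewrite subr_ge0.
have [t0|t0] := eqVneq `|t| 0.
  have -> : D = 0.
    rewrite /D t0; apply/eqP; rewrite subr_eq0 eq_sym eq_le.
    by apply/andP; split => //; rewrite -t0.
  by rewrite mulr0 ltW.
have tp : 0 < `|t| by rewrite lt_neqAle eq_sym t0/=.
have kb : 2 * M / e < k.+1%:R.
  apply: lt_trans (_ : k%:R < _); last by rewrite ltr_nat.
  by apply: archi_boundP; rewrite divr_ge0 ?mulr_ge0 ?ltW.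
have h1 : D * (k.+1%:R / 2) <= 1.
  rewrite -(ler_pM2r tp) mul1r; apply: le_trans pk.
  have e1 : D * (k.+1%:R / 2) * `|t| = D * (k.+1%:R * (`|t| / 2)) by field.
  by rewrite e1; lra.
have h2 : M <= e * (k.+1%:R / 2).
  by move: kb; rewrite ltr_pdivrMr// => /ltW; lra.
have h3 : M * D <= e * (k.+1%:R / 2) * D by rewrite ler_wpM2r.
have h4 : e * (D * (k.+1%:R / 2)) <= e * 1 by rewrite ler_wpM2l// ltW.
by lra.
Qed.

(** min(f, g) = (f + g - |f - g|) / 2. *)
Lemma ucl_min f g : cl f -> cl g -> cl (fun x => Num.min (f x) (g x)).
Proof.
move=> cf cg; have := uclZ 2^-1 (uclB (uclD cf cg) (ucl_abs (uclB cf cg))).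
congr cl; apply/funext => x.
have [fg|fg] := leP (f x) (g x).
- by rewrite ler0_norm ?subr_le0//; field.
- by rewrite gtr0_norm ?subr_gt0//; field.
Qed.

Lemma ucl_seq_min (I : eqType) (g : I -> V -> R) (i0 : I) (s : seq I) :
  (forall i, cl (g i)) ->
  exists F, [/\ cl F, forall x i, i \in i0 :: s -> F x <= g i x &
    forall x, exists2 i, i \in i0 :: s & F x = g i x].
Proof.
move=> cg; elim: s => [|j s [F [cF Fle Fex]]].
  exists (g i0); split=> // [x i|x]; first by rewrite inE => /eqP ->.
  by exists i0 => //; rewrite inE.
exists (fun x => Num.min (F x) (g j x)); split=> [|x i|x].
- exact: ucl_min.
- rewrite !inE => /or3P[/eqP ->|/eqP ->|si].
  + by rewrite ge_min Fle// inE eqxx.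
  + by rewrite ge_min lexx orbT.
  + by rewrite ge_min Fle// inE si orbT.
- have [_|_] := leP (F x) (g j x).
  + have [i + ->] := Fex x; exists i => //.
    by move: p; rewrite !inE => /orP[->//|->]; rewrite !orbT.
  + by exists j => //; rewrite !inE eqxx orbT.
Qed.

End uniform_closure.

(** * Uniform density of the span of exponentials *)

Section expR_bounds.
Context (R : realType).
Implicit Types a b M : R.

Lemma expR_sub_le a b : expR a - expR b <= expR a * (a - b).
Proof.
have e : expR a * expR (b - a) = expR b by rewrite -expRD; congr expR; ring.
by have := expR_ge1Dx (b - a); rewrite -(ler_pM2l (expR_gt0 a)) e; lra.
Qed.

Lemma expR_Lipschitz M a b : a <= M -> b <= M ->
  `|expR a - expR b| <= expR M * `|a - b|.
Proof.
have key u v : u <= M -> expR u - expR v <= expR M * `|u - v|.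
  move=> uM; apply: (le_trans (expR_sub_le u v)).
  apply: (@le_trans _ _ (expR u * `|u - v|)).
    by rewrite ler_wpM2l ?expR_ge0// ler_norm.
  by rewrite ler_wpM2r// ler_expR.
move=> aM bM; rewrite ler_norml key// andbT lerNl opprB distrC; exact: key.
Qed.

(** On [-M, +oo) the derivative of exp is at least exp(-M). *)
Lemma expR_antiLipschitz M a b : - M <= a -> - M <= b ->
  `|a - b| <= expR M * `|expR a - expR b|.
Proof.
have pos u v : - M <= v -> v <= u -> `|u - v| <= expR M * `|expR u - expR v|.
  move=> Mv vu; rewrite !ger0_norm ?subr_ge0 ?ler_expR//.
  have h := expR_sub_le v u.
  have h1 : expR v * (u - v) <= expR u - expR v by lra.
  have h2 : 1 <= expR M * expR v by rewrite -expRD -expR0 ler_expR; lra.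
  have h3 : 0 <= u - v by rewrite subr_ge0.
  apply: (@le_trans _ _ (expR M * (expR v * (u - v)))).
    by rewrite mulrA ler_peMl.
  by rewrite ler_wpM2l// expR_ge0.
move=> Ma Mb; have [ab|/ltW ba] := leP b a; first exact: pos.
by rewrite distrC (distrC (expR a)); exact: pos.
Qed.

End expR_bounds.

Section exponential_span.
Context (R : realType) (d : nat).
Local Notation V := 'rV[R]_d.

Inductive expspan : (V -> R) -> Prop :=
| expspan1 c theta : expspan (fun x => c * expR (dotv theta x))
| expspanD f g : expspan f -> expspan g -> expspan (fun x => f x + g x).

Lemma expspan_cst c : expspan (fun=> c).
Proof.
have -> : (fun=> c) = (fun x : V => c * expR (dotv 0 x)); last exact: expspan1.
by apply/funext => x; rewrite -(scale0r 0) dotvZl mul0r expR0 mulr1.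
Qed.

(** The product of the exponentials of two linear forms is the exponential of their sum, so the span
    is an algebra. *)
Lemma expspanM f g : expspan f -> expspan g -> expspan (fun x => f x * g x).
Proof.
move=> Ef; elim: Ef g => [c th|f1 f2 _ IH1 _ IH2] g Eg; last first.
  have -> : (fun x => (f1 x + f2 x) * g x) = (fun x => f1 x * g x + f2 x * g x).
    by apply/funext => x; rewrite mulrDl.
  by apply: expspanD; [exact: IH1|exact: IH2].
elim: Eg => [c' th'|g1 g2 _ IH1 _ IH2].
  have -> : (fun x => c * expR (dotv th x) * (c' * expR (dotv th' x))) =
            (fun x => c * c' * expR (dotv (th + th') x)).
    by apply/funext => x; rewrite dotvDl expRD; ring.
  exact: expspan1.
have -> : (fun x => c * expR (dotv th x) * (g1 x + g2 x)) =
  (fun x => c * expR (dotv th x) * g1 x + c * expR (dotv th x) * g2 x).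
  by apply/funext => x; rewrite mulrDr.
exact: expspanD.
Qed.

Lemma continuous_expdot (theta : V) : continuous (fun x => expR (dotv theta x)).
Proof.
move=> x; exact: (cvg_comp _ _ (@continuous_dotv R d theta x) (@continuous_expR R _)).
Qed.

Lemma expspan_continuous f : expspan f -> continuous f.
Proof.
elim=> [c th x|f1 f2 _ IH1 _ IH2 x].
  by apply: (@cvgM _ _ (nbhs x)); [exact: cvg_cst|exact: continuous_expdot].
exact: (@cvgD _ _ _ (nbhs x) _ f1 f2 _ _ (IH1 x) (IH2 x)).
Qed.

Lemma norm_le_coord (x : V) c : 0 <= c -> (forall j, `|x 0 j| <= c) -> `|x| <= c.
Proof.
move=> c0 xc; rewrite /Num.norm /= mx_normrE; apply: bigmax_le => //= -[i j] _ /=.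
by rewrite (ord1 i).
Qed.

Lemma dotv_delta j (x : V) : dotv (delta_mx 0 j) x = x 0 j.
Proof.
rewrite /dotv (bigD1 j)//= mxE !eqxx mul1r big1 ?addr0// => k kj.
by rewrite mxE eqxx (negbTE kj) mul0r.
Qed.

Variable X : set V.
Hypothesis Xc : compact X.

Lemma expspan_bnd f : expspan f -> exists2 M, 0 < M & forall x, X x -> `|f x| <= M.
Proof. by move=> /expspan_continuous cf; exact: compact_continuous_bound. Qed.

Local Notation cl := (uclosure X expspan).

Let ucl_sum (I : Type) (s : seq I) (g : I -> V -> R) : (forall i, cl (g i)) ->
  cl (fun x => \sum_(i <- s) g i x).
Proof.
move=> cg; elim: s => [|i s IH].
  by under eq_fun do rewrite big_nil; exact/ucl_cst/expspan_cst.
under eq_fun do rewrite big_cons.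
by apply: uclD => //; exact: expspanD.
Qed.

(** On a bounded set this is comparable to the norm distance, because exp is bi-Lipschitz there. *)
Let expdist (y x : V) := \sum_(j < d) `|expR (x 0 j) - expR (y 0 j)|.

Let ucl_expdist y : cl (expdist y).
Proof.
apply: ucl_sum => j.
apply: (ucl_abs (@expspan_cst) (@expspanD) (@expspanM) expspan_bnd
  (f := fun x => expR (x 0 j) - expR (y 0 j))).
apply: ucl_sub.
have -> : (fun x : V => expR (x 0 j) - expR (y 0 j)) =
  (fun x => 1 * expR (dotv (delta_mx 0 j) x) + - expR (y 0 j)).
  by apply/funext => x; rewrite dotv_delta mul1r.
by apply: expspanD; [exact: expspan1|exact: expspan_cst].
Qed.

(* Functions of the form min over y of f y + K * dist(y, x), with y in a finite
   net, approximate f; here dist is built from exponentials of coordinates, so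
   these functions lie in the closure of the exponential algebra. *)
Lemma expspan_dense f : continuous f -> cl f.
Proof.
move=> cf.
have [C C0 XC] := compact_norm_bound Xc.
have [M M0 fM] := compact_continuous_bound Xc cf.
apply: ucl_closed => e e0.
have e20 : 0 < e / 2 by rewrite divr_gt0.
have [dl dl0 fdl] := compact_uniform_modulus Xc cf e20.
pose A := expR C; have A0 : 0 < A := expR_gt0 _.
(* [K] is so large that a net point at distance at least [dl] from x pays 2 M or more and cannot
   bring the minimum below f x; [eta] below is so small that a net point within [eta] of x pays at
   most e / 2. *)
pose K := 2 * M * A / dl; have K0 : 0 < K by rewrite divr_gt0// !mulr_gt0.
pose B := K * (d%:R * A) + 1.
have B0 : 0 < B by rewrite ltr_wpDl// (mulr_ge0 (ltW K0))// mulr_ge0// ltW.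
pose eta := Num.min dl (e / 2 / B).
have eta0 : 0 < eta by rewrite lt_min dl0 !divr_gt0.
have [s [sX sP]] := compact_finite_net Xc eta0.
have XCj x j : X x -> - C <= x 0 j <= C.
  by move=> Xx; rewrite -ler_norml (le_trans (le_coord_norm _ _))// XC.
have expdist_ge x y : X x -> X y -> `|x - y| <= A * expdist y x.
  move=> Xx Xy; apply: norm_le_coord => [|j].
    by rewrite mulr_ge0 ?(ltW A0)//; exact: sumr_ge0.
  have /andP[xj _] := XCj x j Xx; have /andP[yj _] := XCj y j Xy.
  rewrite !mxE; apply: (le_trans (expR_antiLipschitz xj yj)).
  by rewrite ler_wpM2l ?(ltW A0)// /expdist (bigD1 j)//= lerDl; exact: sumr_ge0.
have expdist_le x y : X x -> X y -> expdist y x <= d%:R * A * `|x - y|.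
  move=> Xx Xy; apply: (@le_trans _ _ (\sum_(j < d) A * `|x - y|)).
    apply: ler_sum => j _.
    have /andP[_ xj] := XCj x j Xx; have /andP[_ yj] := XCj y j Xy.
    apply: (le_trans (expR_Lipschitz xj yj)); rewrite ler_wpM2l ?(ltW A0)//.
    by have := le_coord_norm (x - y) j; rewrite !mxE.
  by rewrite sumr_const card_ord -mulrA -[leLHS]mulr_natl.
(* An empty net means that [X] is empty, and any function of the closure will do. *)
case: s sX sP => [|y0 s] sX sP.
  exists (fun=> 0) => [|x /sP[y]]; first exact/ucl_cst/expspan_cst.
  by rewrite in_nil.
have cg y : cl (fun x => f y + K * expdist y x).
  apply: uclD; [exact: expspanD|exact/ucl_cst/expspan_cst|].
  by apply: uclZ => //; [exact: expspan_cst|exact: expspanM|exact: expspan_bnd].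
have [F [cF Fle Fex]] :=
  ucl_seq_min (@expspan_cst) (@expspanD) (@expspanM) expspan_bnd y0 s cg.
exists F => // x Xx; rewrite ler_norml; apply/andP; split.
- have [y ys xy] := sP x Xx.
  have Xy := sX _ ys.
  have h1 : F x <= f y + K * expdist y x := Fle x y ys.
  have h2 : `|f x - f y| < e / 2.
    by apply: fdl => //; apply: (lt_le_trans xy); rewrite ge_min lexx.
  have h3 : K * expdist y x <= K * (d%:R * A * `|x - y|).
    by rewrite ler_wpM2l ?(ltW K0)// expdist_le.
  have h4 : B * `|x - y| <= e / 2.
    have : `|x - y| <= e / 2 / B by apply: (le_trans (ltW xy)); rewrite ge_min lexx orbT.
    by rewrite ler_pdivlMr// mulrC.
  have h5 : 0 <= `|x - y| by [].
  move: h2; rewrite ltr_norml => /andP[h2 _].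
  by rewrite /B in h4; lra.
- have [y ys ->] := Fex x; have Xy := sX _ ys.
  have [xy|xy] := ltP `|x - y| dl.
    have := fdl x y Xx xy; rewrite ltr_norml => /andP[_ h2].
    have : 0 <= K * expdist y x by rewrite mulr_ge0 ?(ltW K0)//; exact: sumr_ge0.
    by lra.
  have h1 : dl <= A * expdist y x := le_trans xy (expdist_ge x y Xx Xy).
  have h2 : 2 * M <= K * expdist y x.
    have -> : K * expdist y x = 2 * M / dl * (A * expdist y x).
      by rewrite /K; field; rewrite gt_eqF.
    apply: (@le_trans _ _ (2 * M / dl * dl)); first by rewrite divfK ?gt_eqF.
    by rewrite ler_wpM2l// divr_ge0 ?mulr_ge0// ltW.
  have := fM x Xx; rewrite ler_norml => /andP[_ fx].
  have := fM y Xy; rewrite ler_norml => /andP[fy _].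
  by lra.
Qed.

End exponential_span.

(** * Finite measures carried by a compact set *)

Section compact_support.
Context (R : realType) (d : nat) (X : set 'rV[R]_d).
Hypothesis Xc : compact X.

Lemma compact_measurable_Rd : measurable (X : set (Rd R d)).
Proof.
by apply: closed_measurable_Rd; apply: compact_closed => //; exact: norm_hausdorff.
Qed.

(** Finitely many open sets of finite mass cover [X], and the complement of [X] is null. *)
Lemma radon_in_finite (alpha : {measure set (Rd R d) -> \bar R}) :
  radon_in X alpha -> (alpha setT < +oo)%E.
Proof.
move=> [lf aX].
have [U UP] := choice lf.
have [D _ XD] : finite_subset_cover setT U X.
  move: Xc; rewrite compact_cover; apply.
  - by move=> x _; case: (UP x).
  - by move=> x _; exists x => //; case: (UP x).
have mU x : measurable (U x : set (Rd R d)).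
  by apply: open_measurable_Rd; case: (UP x).
pose W (s : seq 'rV[R]_d) : set (Rd R d) := \big[setU/set0]_(x <- s) U x.
have W_fin s : measurable (W s) /\ (alpha (W s) < +oo)%E.
  rewrite /W; elim: s => [|x s [mW IH]].
    by rewrite big_nil measure0.
  rewrite big_cons; split; first exact: measurableU.
  apply: (le_lt_trans (measureU2 _ (mU x) mW)).
  by apply: lte_add_pinfty => //; case: (UP x).
have [mW fW] := W_fin (finmap.enum_fset D).
have XW : X `<=` W (finmap.enum_fset D).
  by move=> x /XD[y /= yD Uxy]; rewrite /W -bigcup_seq; exists y.
have mX := compact_measurable_Rd.
have fX : (alpha (~` X) < +oo)%E by rewrite aX.
have -> : [set: Rd R d] = X `|` ~` X by rewrite setUv.
apply: (le_lt_trans (measureU2 _ mX (measurableC mX))).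
apply: lte_add_pinfty; last exact: fX.
apply: le_lt_trans fW; apply: le_measure; [exact: mem_set|exact: mem_set|exact: XW].
Qed.

Variable m : {measure set (Rd R d) -> \bar R}.
Hypotheses (mfin : (m setT < +oo)%E) (mX0 : m (~` X) = 0%E).

Let mX := compact_measurable_Rd.

Let mX_lty : (m X < +oo)%E.
Proof. by apply: le_lt_trans mfin; apply: le_measure; [exact: mem_set|exact: mem_set|]. Qed.

Lemma integrable_continuous (f : 'rV[R]_d -> R) : continuous f ->
  m.-integrable X (EFin \o f).
Proof.
move=> cf; apply: measurable_bounded_integrable => //.
  by apply: measurable_funTS; exact: continuous_measurable_Rd.
have [M M0 fM] := compact_continuous_bound Xc cf.
exists M; split; first exact: num_real.
by move=> t Mt x Xx /=; rewrite (le_trans (fM x Xx))// ltW.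
Qed.

(** Outside [X] the function may be unbounded, but only on a null set; weak convergence can
    therefore be studied with real-valued integrals over [X]. *)
Lemma integral_setT_continuous (f : 'rV[R]_d -> R) : continuous f ->
  (\int[m]_x (f x)%:E = (\int[m]_(x in X) f x)%:E)%E.
Proof.
move=> cf; have ifX := integrable_continuous cf.
pose N : set (Rd R d) := ~` X.
have XE : setT `\` N = (X : set (Rd R d)) by rewrite setTD setCK.
have mN : measurable N by exact: measurableC.
have mf : measurable_fun [set: Rd R d] (EFin \o f).
  by apply/measurable_EFinP; exact: continuous_measurable_Rd.
rewrite (negligible_integral mN) ?XE//.
- by rewrite /Rintegral fineK//; exact: integrable_fin_num.
- by rewrite (negligible_integrable mN) ?XE.
Qed.

Lemma Rintegral_close (f g : 'rV[R]_d -> R) (e : R) :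
  continuous f -> continuous g ->
  (forall x, X x -> `|f x - g x| <= e) ->
  `|\int[m]_(x in X) f x - \int[m]_(x in X) g x| <= e * fine (m setT).
Proof.
move=> cf cg fg; have iF := integrable_continuous cf; have ig := integrable_continuous cg.
have ifg : m.-integrable X (EFin \o (fun x => f x - g x)).
  by apply: integrable_continuous => x; apply: (@cvgB _ _ _ (nbhs x)); [exact: cf|exact: cg].
rewrite -RintegralB//; apply: (le_trans (le_normr_Rintegral mX ifg)).
apply: (@le_trans _ _ (\int[m]_(x in X) cst e x)).
  apply: le_Rintegral => //.
  - exact: integrable_norm.
  - by apply: integrable_continuous => x; apply: cst_continuous.
rewrite Rintegral_cst//.
have mXT : m X = m setT.
  have : (m X <= m setT)%E by apply: le_measure; [exact: mem_set|exact: mem_set|].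
  have -> : [set: Rd R d] = X `|` ~` X by rewrite setUv.
  rewrite measureU0//; exact: measurableC.
by rewrite mXT.
Qed.

End compact_support.

(** * From ridge functions in nearby directions to weak convergence *)

Section ridge_to_weak.
Context (R : realType) (d : nat) (hd : (0 < d)%N) (X : set 'rV[R]_d).
Hypothesis Xc : compact X.
Variables (alpha_ : nat -> {measure set (Rd R d) -> \bar R})
  (alpha : {measure set (Rd R d) -> \bar R}).
Hypotheses (ha_ : forall n, radon_in X (alpha_ n)) (ha : radon_in X alpha).

Let fin_ n : (alpha_ n setT < +oo)%E := radon_in_finite Xc (ha_ n).
Let fin : (alpha setT < +oo)%E := radon_in_finite Xc ha.

Local Notation I_ n f := (\int[alpha_ n]_(x in X) f x).
Local Notation I f := (\int[alpha]_(x in X) f x).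

Definition ridge_close (B L e : R) (theta : 'rV[R]_d)
    (mu nu : {measure set (Rd R d) -> \bar R}) :=
  forall psi : R -> R, (forall x, 0 <= psi x <= B) ->
  (forall x y, `|psi x - psi y| <= L * `|x - y|) ->
  (\int[mu]_x (psi (dotv theta x))%:E <= \int[nu]_x (psi (dotv theta x))%:E + e%:E /\
  \int[nu]_x (psi (dotv theta x))%:E <= \int[mu]_x (psi (dotv theta x))%:E + e%:E)%E.

(** The direction may change with [n]: a small average over the sphere gives a good direction in
    each small ball, not in a prescribed place. *)
Hypothesis ridge : forall theta0, enorm theta0 = 1 ->
  forall B L r e, 0 <= B -> 0 <= L -> 0 < r -> 0 < e ->
  \forall n \near \oo, exists2 theta, `|theta - theta0| < r &
    ridge_close B L e theta (alpha_ n) alpha.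

Let continuous_ridge (psi : R -> R) (L : R) theta :
  (forall x y, `|psi x - psi y| <= L * `|x - y|) ->
  continuous (fun x : 'rV[R]_d => psi (dotv theta x)).
Proof.
move=> psiL x.
have cpsi : continuous psi := Lipschitz_continuous psiL.
exact: (cvg_comp _ _ (@continuous_dotv R d theta x) (cpsi _)).
Qed.

Let ridge_closeR (B L e : R) theta n (psi : R -> R) :
  ridge_close B L e theta (alpha_ n) alpha ->
  (forall x, 0 <= psi x <= B) ->
  (forall x y, `|psi x - psi y| <= L * `|x - y|) ->
  `|I_ n (fun x => psi (dotv theta x)) - I (fun x => psi (dotv theta x))| <= e.
Proof.
move=> rc psiB psiL; have [] := rc psi psiB psiL.
have cpsi := @continuous_ridge _ _ theta psiL.
rewrite (integral_setT_continuous Xc (fin_ n) (ha_ n).2 cpsi).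
rewrite (integral_setT_continuous Xc fin ha.2 cpsi).
rewrite -!EFinD !lee_fin => h1 h2.
by rewrite ler_norml; apply/andP; split; lra.
Qed.

Let unit_vector : exists theta0 : 'rV[R]_d, enorm theta0 = 1.
Proof.
exists (delta_mx 0 (Ordinal hd)); apply/enorm1.
by rewrite dotv_delta mxE !eqxx.
Qed.

(** The constant profile 1 compares the total masses. *)
Let mass_bound : \forall n \near \oo, fine (alpha_ n setT) <= fine (alpha setT) + 1.
Proof.
have [theta0 th0] := unit_vector.
near=> n.
have [theta _ rc] : exists2 theta, `|theta - theta0| < 1 &
    ridge_close 1 0 1 theta (alpha_ n) alpha.
  by near: n; apply: ridge.
have [|x y|] := rc (fun=> 1); first by move=> _; rewrite ler01 lexx.
  by rewrite subrr normr0 mul0r.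
have c1 (m : {measure set (Rd R d) -> \bar R}) : (\int[m]_x 1%:E = m setT)%E.
  by have := integral_cst m measurableT 1%E; rewrite mul1e.
rewrite !c1 -[alpha_ n _]fineK ?ge0_fin_numE// -[alpha _]fineK ?ge0_fin_numE//.
Unshelve. all: by end_near. Qed.

(** Replacing [theta0] by the nearby good direction changes the integrand by O(r) uniformly on [X].
    As the masses are bounded, one third of [e] pays for this under each measure, and the last third
    for the comparison in the good direction. *)
Let cvg_ridge (psi : R -> R) (B L : R) theta0 : enorm theta0 = 1 ->
  0 <= B -> 0 <= L -> (forall x, 0 <= psi x <= B) ->
  (forall x y, `|psi x - psi y| <= L * `|x - y|) ->
  I_ n (fun x => psi (dotv theta0 x)) @[n --> \oo] --> I (fun x => psi (dotv theta0 x)).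
Proof.
move=> th0 B0 L0 psiB psiL; have [C C0 XC] := compact_norm_bound Xc.
apply/cvgrPdist_le => e e0.
pose A := fine (alpha setT) + 1.
have fa0 : 0 <= fine (alpha setT) by rewrite fine_ge0.
have A0 : 0 < A by rewrite ltr_wpDl.
pose Q := L * d%:R * C * A + 1.
have Q0 : 0 < Q by rewrite ltr_wpDl// (mulr_ge0 _ (ltW A0))// (mulr_ge0 _ (ltW C0))// mulr_ge0.
pose r := e / 3 / Q; have r0 : 0 < r by rewrite !divr_gt0.
have e30 : 0 < e / 3 by rewrite divr_gt0.
near=> n.
have [theta thr rc] : exists2 theta, `|theta - theta0| < r &
    ridge_close B L (e / 3) theta (alpha_ n) alpha.
  by near: n; apply: ridge.
have mn : fine (alpha_ n setT) <= A by near: n; exact: mass_bound.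
have h := ridge_closeR rc psiB psiL.
have cth := @continuous_ridge _ _ theta psiL; have cth0 := @continuous_ridge _ _ theta0 psiL.
have pt x : X x -> `|psi (dotv theta x) - psi (dotv theta0 x)| <= L * (d%:R * (r * C)).
  move=> Xx; apply: (le_trans (psiL _ _)); rewrite ler_wpM2l// -dotvBl.
  by apply: (le_trans (norm_dotv_le _ _)); rewrite ler_wpM2l// ler_pM// ?XC// ltW.
have h1 := Rintegral_close Xc (fin_ n) (ha_ n).2 cth cth0 pt.
have h2 := Rintegral_close Xc fin ha.2 cth cth0 pt.
have c0 : 0 <= L * (d%:R * (r * C)).
  by rewrite mulr_ge0// mulr_ge0// mulr_ge0// ltW.
have rQ : r * Q = e / 3 by rewrite /r divfK ?gt_eqF.
have k : L * (d%:R * (r * C)) * A <= e / 3.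
  by rewrite -rQ /Q; have := ltW r0; lra.
have k1 : L * (d%:R * (r * C)) * fine (alpha_ n setT) <= e / 3.
  by apply: le_trans k; rewrite ler_wpM2l.
have k2 : L * (d%:R * (r * C)) * fine (alpha setT) <= e / 3.
  by apply: le_trans k; rewrite ler_wpM2l// lerDl.
move: h h1 h2.
rewrite !ler_norml => /andP[h3 h4] /andP[h5 h6] /andP[h7 h8].
by apply/andP; split; lra.
Unshelve. all: by end_near. Qed.

(** The exponential is neither bounded nor Lipschitz on the line. Clamping its argument to [-K, K]
    makes it so and changes nothing on [X], where |<theta0, x>| <= d C = K. *)
Let cvg_exp_unit t theta0 : enorm theta0 = 1 ->
  I_ n (fun x => expR (t * dotv theta0 x)) @[n --> \oo] -->
  I (fun x => expR (t * dotv theta0 x)).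
Proof.
move=> th0; have [C C0 XC] := compact_norm_bound Xc.
pose K := d%:R * C; have K0 : 0 <= K by rewrite mulr_ge0// ltW.
pose clamp s := Num.max (- K) (Num.min K s).
have clampE s : `|s| <= K -> clamp s = s.
  by rewrite ler_norml /clamp => /andP[h1 h2]; rewrite min_r// max_r.
have clampK s : `|clamp s| <= K.
  by rewrite ler_norml /clamp le_max lexx/= ge_max ge_min lexx/= andbT; lra.
have clampL s s' : `|clamp s - clamp s'| <= `|s - s'|.
  rewrite /clamp; have [] := leP K s; have [] := leP K s';
    repeat match goal with |- context [Num.max ?a ?b] => have [] := leP a b end;
    rewrite ?ler_norml; intros; case: (ler0P (s - s')) => ?; apply/andP; split; lra.
pose psi s := expR (t * clamp s).
have tK s : t * clamp s <= `|t| * K.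
  by apply: le_trans (ler_norm _) _; rewrite normrM ler_wpM2l.
have psiB s : 0 <= psi s <= expR (`|t| * K) by rewrite expR_ge0 ler_expR tK.
have psiL s s' : `|psi s - psi s'| <= expR (`|t| * K) * `|t| * `|s - s'|.
  apply: (le_trans (expR_Lipschitz (tK s) (tK s'))).
  rewrite -mulrBr normrM -mulrA ler_wpM2l ?expR_ge0// ler_wpM2l//; exact: clampL.
have := cvg_ridge th0 (expR_ge0 _) _ psiB psiL.
have E (m : {measure set (Rd R d) -> \bar R}) :
    \int[m]_(x in X) expR (t * dotv theta0 x) = \int[m]_(x in X) psi (dotv theta0 x).
  apply: eq_Rintegral => x /set_mem Xx; rewrite /psi clampE//.
  apply: (le_trans (norm_dotv_le _ _)); rewrite ler_wpM2l//.
  by rewrite -[leRHS]mul1r ler_pM// ?enorm1_norm_le// XC.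
rewrite E; under [X in _ -> X @ _ --> _]eq_fun do rewrite E.
by apply; rewrite mulr_ge0 ?expR_ge0.
Qed.

(** Polar form theta = t theta0. For theta = 0 one takes t = 0 and any unit vector, which exists
    because d > 0. *)
Let cvg_exp theta :
  I_ n (fun x => expR (dotv theta x)) @[n --> \oo] --> I (fun x => expR (dotv theta x)).
Proof.
have [t [theta0 [th0 E]]] : exists t theta0, enorm theta0 = 1 /\
    forall x, dotv theta x = t * dotv theta0 x.
  have [t0|t0] := eqVneq (enorm theta) 0.
    have [theta0 th0] := unit_vector; exists 0, theta0; split=> // x.
    have th : dotv theta theta = 0 by rewrite -(sqr_sqrtr (dotvv_ge0 _)) -/(enorm _) t0 expr0n.
    have : `|theta| ^+ 2 <= 0 by rewrite -th sqr_norm_le_dotv.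
    rewrite le_eqVlt ltNge sqr_ge0 orbF expf_eq0/= normr_eq0 => /eqP ->.
    by rewrite mul0r -(scale0r 0) dotvZl mul0r.
  exists (enorm theta), ((enorm theta)^-1 *: theta); split=> [|x].
    apply/enorm1; rewrite dotvZl dotvC dotvZl -(sqr_sqrtr (dotvv_ge0 theta)) -/(enorm _).
    by field.
  by rewrite dotvZl mulrA mulfV// mul1r.
have E' : (fun x => expR (dotv theta x)) = (fun x => expR (t * dotv theta0 x)).
  by apply/funext => x; rewrite E.
by rewrite E'; exact: cvg_exp_unit.
Qed.

Let cvg_expspan f : expspan f -> I_ n f @[n --> \oo] --> I f.
Proof.
elim=> [c th|f1 f2 E1 IH1 E2 IH2].
  have E (m : {measure set (Rd R d) -> \bar R}) : radon_in X m ->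
    \int[m]_(x in X) (c * expR (dotv th x)) = c * \int[m]_(x in X) (expR (dotv th x)).
    move=> hm; rewrite RintegralZl//; first exact: compact_measurable_Rd.
    apply: (integrable_continuous Xc (radon_in_finite Xc hm)); exact: continuous_expdot.
  rewrite E//; under eq_fun do rewrite E//.
  by apply: cvgM; [exact: cvg_cst|exact: cvg_exp].
have E (m : {measure set (Rd R d) -> \bar R}) : radon_in X m ->
    \int[m]_(x in X) (f1 x + f2 x) = \int[m]_(x in X) f1 x + \int[m]_(x in X) f2 x.
  move=> hm; rewrite RintegralD//; first exact: compact_measurable_Rd.
  - apply: (integrable_continuous Xc (radon_in_finite Xc hm)); exact: expspan_continuous.
  - apply: (integrable_continuous Xc (radon_in_finite Xc hm)); exact: expspan_continuous.
by rewrite E//; under eq_fun do rewrite E//; exact: cvgD.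
Qed.

Lemma ridge_weak_cvg : weak_cvg alpha_ alpha.
Proof.
move=> f cf; rewrite (integral_setT_continuous Xc fin ha.2 cf).
under eq_fun do rewrite (integral_setT_continuous Xc (fin_ _) (ha_ _).2 cf).
apply: cvg_EFin; first by near=> n.
rewrite [X in X @ _ --> _](_ : _ = (fun n => I_ n f))//.
apply/cvgrPdist_le => e e0.
pose A := fine (alpha setT) + 1.
have fa0 : 0 <= fine (alpha setT) by rewrite fine_ge0.
have A0 : 0 < A by rewrite ltr_wpDl.
pose e1 := e / 3 / A; have e10 : 0 < e1 by rewrite !divr_gt0.
have [g Eg fg] := expspan_dense Xc cf e10.
have e30 : 0 < e / 3 by rewrite divr_gt0.
have /cvgrPdist_le/(_ _ e30) hg := cvg_expspan Eg.
near=> n.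
have mn : fine (alpha_ n setT) <= A by near: n; exact: mass_bound.
have h : `|I g - I_ n g| <= e / 3 by near: n.
have cg := expspan_continuous Eg.
have h1 := Rintegral_close Xc (fin_ n) (ha_ n).2 cf cg fg.
have h2 := Rintegral_close Xc fin ha.2 cf cg fg.
have e1A : e1 * A = e / 3 by rewrite /e1 divfK ?gt_eqF.
have k1 : e1 * fine (alpha_ n setT) <= e / 3 by rewrite -e1A ler_wpM2l// ltW.
have k2 : e1 * fine (alpha setT) <= e / 3 by rewrite -e1A ler_wpM2l ?(ltW e10)// lerDl.
move: h h1 h2; rewrite !ler_norml => /andP[h3 h4] /andP[h5 h6] /andP[h7 h8].
by apply/andP; split; lra.
Unshelve. all: by end_near. Qed.

End ridge_to_weak.

(** * Extended real limits, and nonnegativity of the costs *)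

Section ereal_limits.
Context (R : realType).
Local Open Scope ereal_scope.

Lemma ecvg0_lt (u : nat -> \bar R) (e : \bar R) :
  u @ \oo --> 0 -> 0 < e -> \forall n \near \oo, u n < e.
Proof.
move=> u0 e0; apply: (u0 [set y | y < e]).
by apply: open_nbhs_nbhs; split => //; exact: open_ereal_lt_ereal.
Qed.

Lemma ge0_ecvg0 (u : nat -> \bar R) : (forall n, 0 <= u n) ->
  (forall e : R, (0 < e)%R -> \forall n \near \oo, u n <= e%:E) -> u @ \oo --> 0.
Proof.
move=> u0 ue; apply/fine_cvgP; split.
  near=> n; rewrite ge0_fin_numE//.
  apply: (@le_lt_trans _ _ 1%:E); last exact: ltry.
  by near: n; exact: ue.
apply/cvgrPdist_le => e e0; near=> n.
have une : u n <= e%:E by near: n; exact: ue.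
have ufin : u n \is a fin_num by rewrite ge0_fin_numE// (le_lt_trans une)// ltry.
by rewrite sub0r normrN ger0_norm ?fine_ge0//= -lee_fin fineK.
Unshelve. all: by end_near. Qed.

Lemma lte_add3 (a b c e : \bar R) : 0 <= a -> 0 <= b -> 0 <= c ->
  a + b + c < e -> [/\ a < e, b < e & c < e].
Proof.
move=> a0 b0 c0 h; split; apply: le_lt_trans h.
- by rewrite -addeA leeDl// adde_ge0.
- by rewrite addeAC leeDr// adde_ge0.
- by rewrite leeDr// adde_ge0.
Qed.

End ereal_limits.

Section sliced_nonneg.
Context (R : realType).
Local Open Scope ereal_scope.

Lemma OT_ge0 (p : R) (mu nu : set R -> \bar R) : 0 <= OT p mu nu.
Proof.
apply: le_ereal_inf_tmp => _ [pi _ <-]; apply: integral_ge0 => z _.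
by rewrite lee_fin cost1_ge0.
Qed.

Lemma UOT_ge0 (p rho : R) (mu nu : {measure set R -> \bar R}) :
  (0 <= rho)%R -> 0 <= UOT p rho mu nu.
Proof.
move=> rho0; apply: le_ereal_inf_tmp => _ [pi _ <-].
apply: adde_ge0; last exact: KLdiv_ge0.
apply: adde_ge0; last exact: KLdiv_ge0.
by apply: integral_ge0 => z _; rewrite lee_fin cost1_ge0.
Qed.

Variables (d : nat) (sigma : {measure set (Rd R d) -> \bar R}) (p rho : R).
Hypothesis rho0 : (0 <= rho)%R.
Implicit Types mu nu : {measure set (Rd R d) -> \bar R}.

Lemma UOT_proj_ge0 mu nu theta :
  0 <= UOT p rho (pushforward mu (proj_theta theta)) (pushforward nu (proj_theta theta)).
Proof.
have [m mE] := pushforward_measure mu (measurable_proj_theta theta).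
have [n nE] := pushforward_measure nu (measurable_proj_theta theta).
by rewrite -mE -nE UOT_ge0.
Qed.

Lemma SUOT_ge0 mu nu : 0 <= SUOT sigma p rho mu nu.
Proof. by apply: integral_ge0 => theta _; exact: UOT_proj_ge0. Qed.

Lemma SOT_ge0 mu nu : 0 <= SOT sigma p mu nu.
Proof. by apply: integral_ge0 => theta _; exact: OT_ge0. Qed.

Lemma USOT_ge0 mu nu : 0 <= USOT sigma p rho mu nu.
Proof.
apply: le_ereal_inf_tmp => _ [pi1 [pi2 ->]].
apply: adde_ge0; last exact: KLdiv_ge0.
by apply: adde_ge0; [exact: SOT_ge0|exact: KLdiv_ge0].
Qed.

(** Markov's inequality for lower integrals: if F >= eta on all of [S], then eta times the indicator
    of [S] lies below [F], and monotonicity bounds the integral from below. *)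
Lemma lower_integral_lt_ex (F : Rd R d -> \bar R) (S : set (Rd R d)) (eta : R) :
  measurable S -> (0 <= eta)%R -> (forall x, 0 <= F x) ->
  \int[sigma]_x F x < eta%:E * sigma S -> exists2 x, S x & F x < eta%:E.
Proof.
move=> mS eta0 F0; apply: contraPP => nex; apply/negP; rewrite -leNgt.
have h x : S x -> eta%:E <= F x.
  by move=> Sx; rewrite leNgt; apply/negP => Fx; apply: nex; exists x.
rewrite -(integral_cst sigma mS eta%:E) integral_mkcond.
apply: ge0_le_lower_integral => x; rewrite patchE; case: ifPn => //.
by move=> /set_mem; exact: h.
Qed.

End sliced_nonneg.

(** * Closeness on ridge functions from small sliced costs *)

Section sliced_to_ridge.
Context (R : realType) (d : nat).
Variables (sigma : {measure set (Rd R d) -> \bar R}) (rho p : R).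
Hypotheses (hsigma : uniform_sphere sigma) (rho0 : 0 < rho) (p1 : 1 <= p).
Variable alpha : {measure set (Rd R d) -> \bar R}.
Hypothesis fin : (alpha setT < +oo)%E.

Let alphaM : (alpha setT <= (fine (alpha setT))%:E)%E.
Proof. by rewrite fineK ?ge0_fin_numE. Qed.

Let M0 : 0 <= fine (alpha setT).
Proof. by rewrite fine_ge0. Qed.

Let S (theta0 : 'rV[R]_d) (r : R) : set (Rd R d) := [set x | `|x - theta0| < r].

Let mS theta0 r : measurable (S theta0 r).
Proof. exact: measurable_norm_ball. Qed.

Local Open Scope ereal_scope.

(** By the Markov-type bound some direction in the ball has cost below [eta]. A near-optimal plan
    there is a near-coupling on the line whose reweighted measures are its own marginals. *)
Lemma SUOT_ridge (theta0 : 'rV[R]_d) (B L r e : R) : enorm theta0 = 1%R ->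
  (0 <= B)%R -> (0 <= L)%R -> (0 < r)%R -> (0 < e)%R ->
  exists2 c : \bar R, 0 < c & forall beta : {measure set (Rd R d) -> \bar R},
    SUOT sigma p rho beta alpha < c ->
    exists2 theta, (`|theta - theta0| < r)%R & ridge_close B L e theta beta alpha.
Proof.
move=> th0 B0 L0 r0 e0.
have [eta eta0 etaP] := @near_coupling_integral R _ R _ _ _ _ _ _ rho0 p1 M0 B0 L0 e0.
exists (eta%:E * sigma (S theta0 r)).
  by rewrite mule_gt0//; exact: uniform_sphere_ball_gt0.
move=> beta /(lower_integral_lt_ex (@mS _ _) (ltW eta0)) [].
  by move=> x; apply: UOT_proj_ge0; exact: ltW.
move=> theta thr U; exists theta => // psi psiB psiL.
have mth := measurable_proj_theta theta.
have [m mE] := pushforward_measure beta mth.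
have [n nE] := pushforward_measure alpha mth.
have mpsi : measurable_fun setT (EFin \o psi).
  by apply/measurable_EFinP; exact: Lipschitz_measurable psiL.
have cv (mu : {measure set (Rd R d) -> \bar R}) (nu : {measure set R -> \bar R}) :
    nu = pushforward mu (proj_theta theta) :> (set R -> \bar R) ->
    \int[mu]_x (psi (dotv theta x))%:E = \int[nu]_x (psi (id x))%:E.
  move=> ->; rewrite (ge0_integral_pushforward mth mu measurableT mpsi)// => x _ /=.
  by rewrite lee_fin; case/andP: (psiB x).
rewrite (cv _ _ mE) (cv _ _ nE).
apply: etaP psiB psiL => //; first by rewrite nE /pushforward preimage_setT.
move: U; rewrite -mE -nE => /ereal_inf_lt[_ [pi _ <-]].
have [P1 P1E] := pushforward_measure pi (@measurable_fst _ _ R R).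
have [P2 P2E] := pushforward_measure pi (@measurable_snd _ _ R R).
move=> /lte_add3[|||h1 h2 h3].
- by apply: integral_ge0 => z _; rewrite lee_fin cost1_ge0.
- exact/KLdiv_ge0/ltW.
- exact/KLdiv_ge0/ltW.
by exists P1, P2, pi; rewrite P1E P2E; split.
Qed.

(** Here the reweighting takes place on R^d before projection: near-optimal [P1] and [P2] come
    first, and a direction is then sought for the balanced transport alone. The minimum in the
    threshold also keeps both divergences below [eta]. *)
Lemma USOT_ridge (theta0 : 'rV[R]_d) (B L r e : R) : enorm theta0 = 1%R ->
  (0 <= B)%R -> (0 <= L)%R -> (0 < r)%R -> (0 < e)%R ->
  exists2 c : \bar R, 0 < c & forall beta : {measure set (Rd R d) -> \bar R},
    USOT sigma p rho beta alpha < c ->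
    exists2 theta, (`|theta - theta0| < r)%R & ridge_close B L e theta beta alpha.
Proof.
move=> th0 B0 L0 r0 e0.
have [eta eta0 etaP] := @near_coupling_integral R _ (Rd R d) _ _ _ _ _ _ rho0 p1 M0 B0 L0 e0.
exists (Order.min eta%:E (eta%:E * sigma (S theta0 r))).
  by rewrite lt_min lte_fin eta0 mule_gt0//; exact: uniform_sphere_ball_gt0.
move=> beta /ereal_inf_lt[_ [P1 [P2 ->]]].
move=> /lte_add3[|||]; [exact: SOT_ge0|exact/KLdiv_ge0/ltW|exact/KLdiv_ge0/ltW|].
rewrite !lt_min => /andP[_ h1] /andP[h2 _] /andP[h3 _].
have [theta thr U] := lower_integral_lt_ex (@mS _ _) (ltW eta0) (fun=> OT_ge0 _ _ _) h1.
exists theta => // psi psiB psiL.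
have mth := measurable_proj_theta theta.
move: U => /ereal_inf_lt[_ [pi piP <-] h4].
apply: (etaP _ _ (proj_theta theta)) psiB psiL => //.
exists P1, P2, pi; split => // A mA; first exact: (piP A mA).1.
exact: (piP A mA).2.
Qed.

End sliced_to_ridge.

(** * Partitions of unity and the plans built from them *)

Lemma compact_partition_of_unity (R : realType) (V : normedModType R) (X : set V) (e : R) :
  compact X -> 0 < e ->
  exists N (h : 'I_N -> V -> R), [/\ forall i, continuous (h i),
    forall i x, 0 <= h i x, forall x, \sum_(i < N) h i x <= 1,
    forall x, X x -> \sum_(i < N) h i x = 1 &
    forall i x y, h i x != 0 -> h i y != 0 -> `|x - y| <= e].
Proof.
move=> Xc e0; have e40 : 0 < e / 4 by rewrite divr_gt0.
have [s [_ sP]] := compact_finite_net Xc e40.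
pose y (i : 'I_(size s)) := nth 0 s i.
(* Tents of radius e / 2 around an e / 4 net, divided by max(S, e / 4). At each point of [X] some
   tent exceeds e / 4, so the denominator is [S]; elsewhere it stays positive and keeps the sum at
   most 1. *)
pose g i x := Num.max 0 (e / 2 - `|x - y i|).
pose S x := \sum_i g i x.
pose Q x := Num.max (S x) (e / 4).
have g0 i x : 0 <= g i x by rewrite le_max lexx.
have S0 x : 0 <= S x by apply: sumr_ge0.
have Q0 x : 0 < Q x by rewrite lt_max e40 orbT.
have cg i : continuous (g i).
  move=> x; apply: (@continuous_max _ _ (fun=> 0) (fun x => e / 2 - `|x - y i|)).
    exact: cst_continuous.
  apply: (@cvgB _ _ _ (nbhs x)); first exact: cvg_cst.
  apply: (@cvg_norm _ _ _ (nbhs x)).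
  by apply: (@cvgB _ _ _ (nbhs x)); [exact: cvg_id|exact: cvg_cst].
have cS : continuous S by move=> x; apply: (@cvg_sumr _ _ (nbhs x)) => i; exact: cg.
have cQ : continuous Q.
  by move=> x; apply: (@continuous_max _ _ S (fun=> e / 4)); [exact: cS|exact: cst_continuous].
exists (size s), (fun i x => g i x / Q x); split.
- move=> i x; apply: (@cvgM _ _ (nbhs x)); first exact: cg.
  by apply: (@cvgV _ _ (nbhs x)); [rewrite gt_eqF|exact: cQ].
- by move=> i x; rewrite divr_ge0// ltW.
- by move=> x; rewrite -mulr_suml ler_pdivrMr// mul1r le_max lexx.
- move=> x Xx; rewrite -mulr_suml -/(S x); have -> : Q x = S x.
    apply/max_idPl; have [z zs xz] := sP x Xx.
    have zi : (index z s < size s)%N by rewrite index_mem.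
    apply: (@le_trans _ _ (g (Ordinal zi) x)).
      by rewrite le_max /y /= nth_index//; apply/orP; right; lra.
    by rewrite /S (bigD1 (Ordinal zi))//= lerDl; exact: sumr_ge0.
  rewrite mulfV// gt_eqF//.
  have [z zs xz] := sP x Xx.
  have zi : (index z s < size s)%N by rewrite index_mem.
  apply: (@lt_le_trans _ _ (g (Ordinal zi) x)).
    by rewrite lt_max /y /= nth_index//; apply/orP; right; lra.
  by rewrite /S (bigD1 (Ordinal zi))//= lerDl; exact: sumr_ge0.
- have supp i x : g i x / Q x != 0 -> `|x - y i| < e / 2.
    apply: contraNT; rewrite -leNgt => h.
    by rewrite /g max_l ?mul0r// subr_le0.
  move=> i x x' /supp h1 /supp h2.
  by have := ler_distD (y i) x x'; rewrite (distrC (y i)); lra.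
Qed.

Section partition_coupling.
Context d (T : measurableType d) (R : realType).
Variables (rho : R) (N : nat) (h : 'I_N -> T -> R) (D : set T).
Hypothesis rho0 : 0 <= rho.
Hypothesis mh : forall i, measurable_fun setT (h i).
Hypothesis h0 : forall i x, 0 <= h i x.
Hypothesis h1 : forall x, \sum_(i < N) h i x <= 1.
Hypothesis mD : measurable D.
Hypothesis hD : forall x, D x -> \sum_(i < N) h i x = 1.
Local Open Scope ereal_scope.

Lemma integral_partition_comb (m : {measure set T -> \bar R}) (w : 'I_N -> R) :
  m setT < +oo -> (forall i, 0 <= w i)%R ->
  \int[m]_x (\sum_(i < N) w i * h i x)%:E =
  (\sum_(i < N) w i * fine (\int[m]_x (h i x)%:E))%:E.
Proof.
move=> mfin w0.
under eq_integral do rewrite -sumEFin.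
rewrite ge0_integral_sum//; last 2 first.
- by move=> i; apply/measurable_EFinP; exact: measurable_funM.
- by move=> i x _; rewrite lee_fin mulr_ge0.
rewrite -sumEFin; apply: eq_bigr => i _.
under eq_integral do rewrite EFinM.
rewrite ge0_integralZl//; last 3 first.
- exact/measurable_EFinP.
- by move=> x _; rewrite lee_fin.
- by rewrite lee_fin.
have I0 : 0 <= \int[m]_x (h i x)%:E by apply: integral_ge0 => x _; rewrite lee_fin.
rewrite EFinM fineK// ge0_fin_numE//; apply: le_lt_trans mfin.
rewrite -[leRHS]mul1e -(integral_cst m measurableT 1).
apply: ge0_le_integral => //.
- by move=> x _; rewrite lee_fin.
- exact/measurable_EFinP.
move=> x _; rewrite lee_fin; apply: le_trans (h1 x).
by rewrite (bigD1 i)//= lerDl sumr_ge0.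
Qed.

Section KL_bound.
Variables (m : {measure set T -> \bar R}) (w a : 'I_N -> R).
Hypothesis mfin : m setT < +oo.
Hypothesis mND : m (~` D) = 0.
Hypothesis w01 : forall i, (0 <= w i <= 1)%R.

Lemma partition_comb_01 x : (0 <= \sum_(i < N) w i * h i x <= 1)%R.
Proof.
apply/andP; split.
  by apply: sumr_ge0 => i _; rewrite mulr_ge0//; case/andP: (w01 i).
apply: le_trans (h1 x); apply: ler_sum => i _.
by rewrite ler_piMl//; case/andP: (w01 i).
Qed.

(** The density f lies in [0, 1], where the entropy is at most rho (1 - f); on [D], 1 - f is the sum
    of the (1 - w i) h i. *)
Lemma KLdiv_partition_le (P : set T -> \bar R) :
  (forall A, measurable A -> P A = \int[m]_(x in A) (\sum_(i < N) w i * h i x)%:E) ->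
  KLdiv rho P m <=
    (rho * \sum_(i < N) (1 - w i) * fine (\int[m]_x (h i x)%:E))%:E.
Proof.
move=> PE; pose f x := (\sum_(i < N) w i * h i x)%R.
have mf : measurable_fun setT f by apply: measurable_sum => i; exact: measurable_funM.
have f01 := partition_comb_01.
apply: le_trans; first apply: (KLdiv_le rho mf _ PE).
  by move=> x; case/andP: (f01 x).
pose v i := (rho * (1 - w i))%R.
have v0 i : (0 <= v i)%R by rewrite mulr_ge0// subr_ge0; case/andP: (w01 i).
have -> : (rho * \sum_(i < N) (1 - w i) * fine (\int[m]_x (h i x)%:E))%:E =
  \int[m]_x (\sum_(i < N) v i * h i x)%:E.
  rewrite integral_partition_comb// mulr_sumr; congr (_%:E).
  by apply: eq_bigr => i _; rewrite mulrA.
apply: ae_ge0_le_integral => //.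
- by move=> x _; rewrite lee_fin phiKL_ge0//; case/andP: (f01 x).
- by apply/measurable_EFinP; exact: measurable_phiKL.
- by move=> x _; rewrite lee_fin; apply: sumr_ge0 => i _; rewrite mulr_ge0.
- by apply/measurable_EFinP; apply: measurable_sum => i; exact: measurable_funM.
exists (~` D); split => //; first exact: measurableC.
move=> x /= nx Dx; apply: nx => _; rewrite lee_fin.
apply: le_trans (phiKL_le rho0 (f01 x)) _.
rewrite -(hD Dx) -sumrB mulr_sumr; apply: ler_sum => i _.
by rewrite /v; lra.
Qed.

End KL_bound.

Section coupling.
Variables mu nu : {finite_measure set T -> \bar R}.

Let a i := fine (\int[mu]_x (h i x)%:E).
Let b i := fine (\int[nu]_x (h i x)%:E).
Let c i := (Num.min (a i) (b i) / (a i * b i))%R.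

Let a0 i : (0 <= a i)%R.
Proof. by apply: fine_ge0; apply: integral_ge0 => x _; rewrite lee_fin. Qed.

Let b0 i : (0 <= b i)%R.
Proof. by apply: fine_ge0; apply: integral_ge0 => x _; rewrite lee_fin. Qed.

Let c0 i : (0 <= c i)%R.
Proof. by apply: divr_ge0; [rewrite le_min a0 b0|exact: mulr_ge0]. Qed.

(** On a cell with masses u and v, w is the weight of the marginal of the plan: w u = min(u, v), so
    the mass lost is u - min(u, v). If u or v vanishes, then w = 0. *)
Let weight (u v : R) : (0 <= u)%R -> (0 <= v)%R ->
  let w := (Num.min u v / (u * v) * v)%R in
  (0 <= w <= 1)%R /\ ((1 - w) * u <= `|u - v|)%R.
Proof.
move=> u0 v0 w.
have [u00|u00] := eqVneq u 0%R.
  by rewrite /w u00 mul0r invr0 mulr0 mul0r lexx ler01 mulr0.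
have [v00|v00] := eqVneq v 0%R.
  by rewrite /w v00 mulr0 lexx ler01 subr0 mul1r subr0 ler_norm.
have up : (0 < u)%R by rewrite lt_neqAle eq_sym u00.
have wE : w = (Num.min u v / u)%R by rewrite /w; field; rewrite u00.
split.
  rewrite wE divr_ge0 ?le_min ?u0 ?v0//= ler_pdivrMr// mul1r.
  by rewrite ge_min lexx.
have -> : ((1 - w) * u = u - Num.min u v)%R by rewrite wE; field.
have [uv|vu] := leP u v; first by rewrite subrr.
exact: ler_norm.
Qed.

Let H (z : T * T) := (\sum_(i < N) c i * (h i z.1 * h i z.2))%R.

Let mH : measurable_fun setT H.
Proof.
apply: measurable_sum => i; apply: measurable_funM => //.
by apply: measurable_funM; exact: measurableT_comp.
Qed.

Let H0 z : (0 <= H z)%R.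
Proof.
by apply: sumr_ge0 => i _; apply: mulr_ge0; [exact: c0|exact: mulr_ge0].
Qed.

Let mEH : measurable_fun setT (fun z => (H z)%:E).
Proof. exact/measurable_EFinP. Qed.

Let mufin : mu setT < +oo. Proof. exact: fin_num_fun_lty (fin_num_measure mu). Qed.
Let nufin : nu setT < +oo. Proof. exact: fin_num_fun_lty (fin_num_measure nu). Qed.

(** Tonelli: integrating out the second variable replaces h_i(y) by its mass [b i]. *)
Let marginal1 A : measurable A ->
  \int[mu \x nu]_(z in fst @^-1` A) (H z)%:E =
  \int[mu]_(x in A) (\sum_(i < N) c i * b i * h i x)%:E.
Proof.
move=> mA; have mfA : measurable (fst @^-1` A : set (T * T)).
  by rewrite -[X in measurable X]setTI; exact: measurable_fst.
rewrite integral_mkcond fubini_tonelli1; last 2 first.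
- by apply: (measurable_restrictT _ mfA).1; exact: measurable_funTS mEH.
- by move=> z; rewrite patchE; case: ifPn => // _; rewrite lee_fin.
rewrite [RHS]integral_mkcond; apply: eq_integral => x _.
rewrite /fubini_F patchE; case: ifPn => xA.
  under eq_integral => y _.
    rewrite patchE ifT; last by apply/mem_set; exact: set_mem xA.
    have -> : H (x, y) = (\sum_(i < N) (c i * h i x) * h i y)%R.
      by apply: eq_bigr => i _; rewrite mulrA.
    over.
  rewrite integral_partition_comb//; last by move=> i; rewrite mulr_ge0.
  by congr (_%:E); apply: eq_bigr => i _; rewrite mulrAC.
rewrite integral0_eq// => y _; rewrite patchE ifF//.
by apply/negbTE; apply: contra xA => /set_mem h2; exact/mem_set.
Qed.

Let marginal2 A : measurable A ->
  \int[mu \x nu]_(z in snd @^-1` A) (H z)%:E =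
  \int[nu]_(x in A) (\sum_(i < N) c i * a i * h i x)%:E.
Proof.
move=> mA; have mfA : measurable (snd @^-1` A : set (T * T)).
  by rewrite -[X in measurable X]setTI; exact: measurable_snd.
rewrite integral_mkcond fubini_tonelli2; last 2 first.
- by apply: (measurable_restrictT _ mfA).1; exact: measurable_funTS mEH.
- by move=> z; rewrite patchE; case: ifPn => // _; rewrite lee_fin.
rewrite [RHS]integral_mkcond; apply: eq_integral => y _.
rewrite /fubini_G patchE; case: ifPn => yA.
  under eq_integral => x _.
    rewrite patchE ifT; last by apply/mem_set; exact: set_mem yA.
    have -> : H (x, y) = (\sum_(i < N) (c i * h i y) * h i x)%R.
      by apply: eq_bigr => i _; rewrite /= mulrA mulrAC.
    over.
  rewrite integral_partition_comb//; last by move=> i; rewrite mulr_ge0.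
  by congr (_%:E); apply: eq_bigr => i _; rewrite mulrAC.
rewrite integral0_eq// => x _; rewrite patchE ifF//.
by apply/negbTE; apply: contra yA => /set_mem h2; exact/mem_set.
Qed.

(* The coupling has density sum_i min(a_i, b_i) / (a_i * b_i) * h_i(x) * h_i(y)
   with respect to the product measure, a_i and b_i being the masses of h_i:
   on each cell it transports as much mass as both measures allow. When a_i or
   b_i vanishes the i-th term is 0, since x / 0 = 0. *)
Lemma finite_partition_coupling : mu (~` D) = 0 -> nu (~` D) = 0 ->
  exists pi : {measure set (T * T)%type -> \bar R},
  [/\ KLdiv rho (pushforward pi fst) mu <= (rho * \sum_(i < N) `|a i - b i|)%:E,
      KLdiv rho (pushforward pi snd) nu <= (rho * \sum_(i < N) `|a i - b i|)%:E &
      forall (k : T * T -> R) (kap : R), measurable_fun setT k ->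
        (forall z, 0 <= k z)%R -> (0 <= kap)%R ->
        (forall i x y, h i x != 0 -> h i y != 0 -> k (x, y) <= kap)%R ->
        \int[pi]_z (k z)%:E <= kap%:E * nu setT].
Proof.
move=> muD nuD; have [pi piE] := density_measure (mu \x nu) mH H0.
have wt1 i := weight (a0 i) (b0 i).
have wt2 i := weight (b0 i) (a0 i).
have cE i : (Num.min (b i) (a i) / (b i * a i) = c i)%R by rewrite minC (mulrC (b i)).
exists pi; split.
- apply: le_trans; first apply: (KLdiv_partition_le (w := fun i => (c i * b i)%R)) => //.
  + by move=> i; case: (wt1 i).
  + by move=> A mA; rewrite /pushforward piE marginal1.
  by rewrite lee_fin ler_wpM2l// ler_sum// => i _; case: (wt1 i).
- apply: le_trans; first apply: (KLdiv_partition_le (w := fun i => (c i * a i)%R)) => //.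
  + by move=> i; rewrite -cE; case: (wt2 i).
  + by move=> A mA; rewrite /pushforward piE marginal2.
  by rewrite lee_fin ler_wpM2l// ler_sum// => i _; rewrite -cE distrC; case: (wt2 i).
move=> k kap mk k0 kap0 kh.
rewrite (ge0_integral_density mH H0 (fun A _ => piE A)); last 2 first.
- exact/measurable_EFinP.
- by move=> z; rewrite lee_fin.
(* A term of [H] vanishes unless both points lie in the same cell, where k <= kap. The mass of the
   plan is at most that of [nu], its second marginal having density at most 1. *)
apply: (@le_trans _ _ (\int[mu \x nu]_z (kap%:E * (H z)%:E))).
  apply: ge0_le_integral => //.
  - by move=> z _; rewrite mule_ge0// lee_fin.
  - by apply: emeasurable_funM; exact/measurable_EFinP.
  - by apply: measurable_funeM; exact/measurable_EFinP.
  move=> [x y] _; rewrite -!EFinM lee_fin !mulr_sumr; apply: ler_sum => i _ /=.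
  have [->|hx] := eqVneq (h i x) 0%R; first by rewrite !(mul0r, mulr0).
  have [->|hy] := eqVneq (h i y) 0%R; first by rewrite !mulr0.
  apply: ler_wpM2r; last exact: kh hx hy.
  by apply: mulr_ge0; [exact: c0|exact: mulr_ge0].
rewrite ge0_integralZl//; last by move=> z _; rewrite lee_fin.
rewrite lee_wpmul2l ?lee_fin//.
have := marginal2 measurableT; rewrite preimage_setT => ->.
rewrite -[leRHS]mul1e -(integral_cst nu measurableT 1).
have w01 i : (0 <= c i * a i <= 1)%R by rewrite -cE; case: (wt2 i).
apply: ge0_le_integral => //.
- by move=> x _; rewrite lee_fin; case/andP: (partition_comb_01 w01 x).
- by apply/measurable_EFinP; apply: measurable_sum => i; exact: measurable_funM.
- by move=> x _; rewrite lee_fin; case/andP: (partition_comb_01 w01 x).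
Qed.

End coupling.

Lemma partition_coupling (mu nu : {measure set T -> \bar R}) :
  mu setT < +oo -> nu setT < +oo -> mu (~` D) = 0 -> nu (~` D) = 0 ->
  let S := (\sum_(i < N) `|fine (\int[mu]_x (h i x)%:E) - fine (\int[nu]_x (h i x)%:E)|)%R in
  exists pi : {measure set (T * T)%type -> \bar R},
  [/\ KLdiv rho (pushforward pi fst) mu <= (rho * S)%:E,
      KLdiv rho (pushforward pi snd) nu <= (rho * S)%:E &
      forall (k : T * T -> R) (kap : R), measurable_fun setT k ->
        (forall z, 0 <= k z)%R -> (0 <= kap)%R ->
        (forall i x y, h i x != 0 -> h i y != 0 -> k (x, y) <= kap)%R ->
        \int[pi]_z (k z)%:E <= kap%:E * nu setT].
Proof.
move=> /fin_measure[mu' muE] /fin_measure[nu' nuE].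
rewrite -muE -nuE; exact: finite_partition_coupling.
Qed.

End partition_coupling.

(** * Sliced costs under weak convergence *)

Section weak_to_sliced.
Context (R : realType) (d : nat).
Variables (sigma : {measure set (Rd R d) -> \bar R}) (rho p : R).
Hypotheses (hsigma : uniform_sphere sigma) (rho0 : 0 < rho) (p1 : 1 <= p).
Variable X : set 'rV[R]_d.
Hypothesis Xc : compact X.
Variables (alpha_ : nat -> {measure set (Rd R d) -> \bar R})
  (alpha : {measure set (Rd R d) -> \bar R}).
Hypotheses (ha_ : forall n, radon_in X (alpha_ n)) (ha : radon_in X alpha).
Hypothesis weak : weak_cvg alpha_ alpha.

Let fin_ n : (alpha_ n setT < +oo)%E := radon_in_finite Xc (ha_ n).
Let fin : (alpha setT < +oo)%E := radon_in_finite Xc ha.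
Let m := fine (alpha setT).
Let p0 : 0 <= p := le_trans ler01 p1.

Let S : set (Rd R d) := [set x : Rd R d | enorm x = 1].

Let mS : measurable S.
Proof. by apply: closed_measurable_Rd; exact: closed_sphere. Qed.

(** The bound holds only on the sphere. Adding +oo to [g] on the null complement extends it
    everywhere without changing the integral of [g], so monotonicity of lower integrals applies. *)
Let lower_integral_sphere_le (F g : Rd R d -> \bar R) :
  (forall x, 0 <= F x)%E -> (forall x, 0 <= g x)%E -> measurable_fun setT g ->
  (forall x, S x -> F x <= g x)%E ->
  (\int[sigma]_x F x <= \int[sigma]_x g x)%E.
Proof.
move=> F0 g0 mg Fg; have [_ sC _] := hsigma.
pose G : Rd R d -> \bar R := (cst +oo%E) \_ (~` S).
have mSC : measurable (~` S) by exact: measurableC.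
have mG : measurable_fun setT G by apply: (measurable_restrictT _ mSC).1.
have G0 x : (0 <= G x)%E by rewrite /G patchE; case: ifPn => _; rewrite ?leey ?lexx.
have GI : (\int[sigma]_x G x = 0)%E.
  rewrite /G -integral_mkcond integral_cst//.
  have -> : sigma (~` S) = 0%E by exact: sC.
  by rewrite mule0.
apply: (@le_trans _ _ (\int[sigma]_x (g x + G x))%E).
  apply: ge0_le_lower_integral => // x; rewrite /G patchE.
  case: ifPn => [|/negP xS]; first by rewrite addey ?leey// gt_eqF// (lt_le_trans _ (g0 x)).
  rewrite adde0; apply: Fg; apply: contrapT => nS; apply: xS; exact/mem_set.
by rewrite ge0_integralD// GI adde0.
Qed.

Let fine_integral_cvg (f : 'rV[R]_d -> R) : continuous f ->
  fine (\int[alpha_ n]_x (f x)%:E)%E @[n --> \oo] --> fine (\int[alpha]_x (f x)%:E)%E.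
Proof.
move=> cf; have := weak cf; rewrite (integral_setT_continuous Xc fin ha.2 cf).
exact: fine_cvg.
Qed.

Let m0 : 0 <= m.
Proof. by rewrite fine_ge0. Qed.

Let mE : alpha setT = m%:E.
Proof. by rewrite fineK// ge0_fin_numE. Qed.

(** For t <= 1 <= p one has t^p <= t, so t (m + 1) <= e is enough; m + 1 is positive even if the
    mass is 0. *)
Let small_cost (e : R) : 0 < e -> exists2 t, 0 < t & t `^ p * m <= e.
Proof.
move=> e0; pose t := Num.min 1 (e / (m + 1)).
have m1 : 0 < m + 1 by rewrite ltr_wpDl.
have t0 : 0 < t by rewrite lt_min ltr01 divr_gt0.
exists t => //; apply: (@le_trans _ _ (t * (m + 1))).
  rewrite ler_pM ?powR_ge0 ?lerDl//.
  by apply: ge1r_powR => //; rewrite t0 ge_min lexx.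
by rewrite -ler_pdivlMr// ge_min lexx orbT.
Qed.

Let norm_proj (theta x : 'rV[R]_d) : S theta -> `|dotv theta x| <= d%:R * `|x|.
Proof.
move=> /enorm1_norm_le th1; apply: (le_trans (norm_dotv_le _ _)).
by rewrite ler_wpM2l// -[leRHS]mul1r ler_wpM2r.
Qed.

(** Projecting both coordinates of a plan on R^d gives a plan between the projected marginals. *)
Let OT_proj_le (pi : {measure set (Rd R d * Rd R d)%type -> \bar R}) theta :
  (OT p (pushforward (pushforward pi fst) (proj_theta theta))
        (pushforward (pushforward pi snd) (proj_theta theta)) <=
   \int[pi]_z (cost1 p (dotv theta z.1, dotv theta z.2))%:E)%E.
Proof.
pose g (z : Rd R d * Rd R d) := (proj_theta theta z.1, proj_theta theta z.2).
have mg : measurable_fun setT g.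
  by apply: measurable_fun_pair; apply: measurableT_comp => //; exact: measurable_proj_theta.
have [gam gamE] := pushforward_measure pi mg.
apply: ge_ereal_inf; exists (\int[gam]_z (cost1 p z)%:E)%E.
  by exists gam => // A mA; rewrite gamE.
rewrite gamE (ge0_integral_pushforward mg pi measurableT)//.
- by apply/measurable_EFinP; exact: measurable_cost1.
- by move=> z _; rewrite lee_fin cost1_ge0.
Qed.

(** A single plan on R^d, built from a partition of unity of [X], serves all directions; its
    marginals are the competitors in the infimum. *)
Lemma weak_USOT : (fun n => USOT sigma p rho (alpha_ n) alpha) @ \oo --> 0%E.
Proof.
apply: ge0_ecvg0 => [n|e e0]; first by apply: USOT_ge0; exact: ltW.
have e20 : 0 < e / 2 by rewrite divr_gt0.
have [t t0 tm] := small_cost e20.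
have d1 : (0 : R) < d%:R + 1 by rewrite ltr_wpDl.
(* A unit direction stretches the sup norm by at most d, so points of one cell of this size have
   projections within t of each other. *)
have td0 : 0 < t / (d%:R + 1) by rewrite divr_gt0.
have [N [h [ch h0 h1 hX hsupp]]] := compact_partition_of_unity Xc td0.
have mh i : measurable_fun [set: Rd R d] (h i : Rd R d -> R) := continuous_measurable_Rd (ch i).
pose s n := \sum_(i < N)
  `|fine (\int[alpha_ n]_x (h i x)%:E)%E - fine (\int[alpha]_x (h i x)%:E)%E|.
have s0 : s n @[n --> \oo] --> 0.
  have -> : 0 = \sum_(i < N)
      `|fine (\int[alpha]_x (h i x)%:E)%E - fine (\int[alpha]_x (h i x)%:E)%E|.
    by rewrite big1// => i _; rewrite subrr normr0.
  apply: cvg_sumr => i; apply: cvg_norm; apply: cvgB; last exact: cvg_cst.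
  exact: fine_integral_cvg.
have c0 : 0 < e / 4 / rho by rewrite !divr_gt0.
have /cvgrPdist_le/(_ _ c0) hs := s0.
near=> n.
have sn : rho * s n <= e / 4.
  have : `|0 - s n| <= e / 4 / rho by near: n.
  by rewrite sub0r normrN => /(le_trans (ler_norm _)); rewrite ler_pdivlMr// mulrC.
have mX : measurable (X : set (Rd R d)) := compact_measurable_Rd Xc.
have [pi [K1 K2 Kc]] := partition_coupling (T := Rd R d) (ltW rho0) mh h0 h1
  mX hX (fin_ n) fin (ha_ n).2 ha.2.
have [P1 P1E] := pushforward_measure pi (@measurable_fst _ _ (Rd R d) (Rd R d)).
have [P2 P2E] := pushforward_measure pi (@measurable_snd _ _ (Rd R d) (Rd R d)).
apply: (@le_trans _ _ (SOT sigma p P1 P2 + KLdiv rho P1 (alpha_ n) + KLdiv rho P2 alpha)%E).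
  by apply: ereal_inf_lbound; exists P1, P2.
have -> : e = e / 2 + e / 4 + e / 4 by field.
rewrite !EFinD; apply: leeD; last by rewrite P2E (le_trans K2)// lee_fin.
apply: leeD; last by rewrite P1E (le_trans K1)// lee_fin.
have -> : (e / 2)%:E = (\int[sigma]_x (cst (e / 2)%:E x))%E.
  by rewrite integral_cst//; have [-> _ _] := hsigma; rewrite mule1.
apply: lower_integral_sphere_le => //.
- by move=> theta; exact: OT_ge0.
- by move=> theta /=; rewrite lee_fin ltW.
move=> theta Sth; rewrite P1E P2E; apply: (le_trans (OT_proj_le pi theta)).
apply: (@le_trans _ _ ((t `^ p)%:E * alpha setT)%E); last by rewrite mE -EFinM lee_fin.
apply: Kc => [|z||i x y hx hy]; [|exact: powR_ge0|exact: powR_ge0|].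
- apply: (measurableT_comp (measurable_cost1 p)).
  by apply: measurable_fun_pair; apply: measurableT_comp => //; exact: measurable_proj_theta.
rewrite /cost1 /= -dotvBr; apply: (ge0_ler_powR p0) => //; rewrite ?nnegrE ?(ltW t0)//.
apply: (le_trans (norm_proj _ Sth)).
apply: (@le_trans _ _ ((d%:R + 1) * (t / (d%:R + 1)))).
  by rewrite ler_pM// ?lerDl// (hsupp i).
by rewrite mulrC divfK// gt_eqF.
Unshelve. all: by end_near. Qed.

Let ridge_mass (mu : {measure set (Rd R d) -> \bar R}) (h : R -> R) theta :=
  fine (\int[mu]_x (h (dotv theta x))%:E)%E.

(** Tonelli for the jointly measurable map (theta, x) to h(<theta, x>). It makes dominated
    convergence in theta available. *)
Let measurable_ridge_mass (mu : {measure set (Rd R d) -> \bar R}) (h : R -> R) :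
  (mu setT < +oo)%E -> measurable_fun setT h -> (forall x, 0 <= h x) ->
  measurable_fun [set: Rd R d] (ridge_mass mu h).
Proof.
move=> /fin_measure[mu' muE] mh h0.
have : measurable_fun [set: Rd R d] (fun theta : Rd R d => \int[mu']_x (h (dotv theta x))%:E)%E.
  apply: (@measurable_fun_fubini_tonelli_F _ _ (Rd R d) (Rd R d) R mu'
    (fun z : Rd R d * Rd R d => (h (dotv z.1 z.2))%:E)).
  - apply/measurable_EFinP; exact: (measurableT_comp mh (@measurable_dotv R d)).
  - by move=> z; rewrite lee_fin.
rewrite muE => mF; exact: (measurableT_comp (@fine_measurable R setT measurableT) mF).
Qed.

Let ridge_mass_le (mu : {measure set (Rd R d) -> \bar R}) (h : R -> R) theta :
  (mu setT < +oo)%E -> measurable_fun setT h -> (forall x, 0 <= h x <= 1) ->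
  0 <= ridge_mass mu h theta <= fine (mu setT).
Proof.
move=> mufin mh h01; rewrite fine_ge0/=; last first.
  by apply: integral_ge0 => x _; rewrite lee_fin; case/andP: (h01 (dotv theta x)).
have I1 : (\int[mu]_x (h (dotv theta x))%:E <= mu setT)%E.
  rewrite -[leRHS]mul1e -(integral_cst mu measurableT 1%E).
  apply: ge0_le_integral => //.
  - by move=> x _; rewrite lee_fin; case/andP: (h01 (dotv theta x)).
  - by apply/measurable_EFinP; exact: (measurableT_comp mh (measurable_proj_theta theta)).
  - by move=> x _; rewrite lee_fin; case/andP: (h01 (dotv theta x)).
apply: fine_le => //; rewrite ge0_fin_numE//.
- by apply: le_lt_trans mufin.
- by apply: integral_ge0 => x _; rewrite lee_fin; case/andP: (h01 (dotv theta x)).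
Qed.

(** The partition of the interval is fixed, but the plan varies with theta. The discrepancies of the
    cell masses tend to 0 for each theta by weak convergence, hence in mean over the sphere by
    dominated convergence. *)
Lemma weak_SUOT : (fun n => SUOT sigma p rho (alpha_ n) alpha) @ \oo --> 0%E.
Proof.
apply: ge0_ecvg0 => [n|e e0]; first by apply: SUOT_ge0; exact: ltW.
have e20 : 0 < e / 2 by rewrite divr_gt0.
have [t t0 tm] := small_cost e20.
have [C C0 XC] := compact_norm_bound Xc.
(* This interval contains the projections of [X] in all unit directions. *)
pose K := d%:R * C; pose D : set R := `[- K, K]%classic.
have Dc : compact D by exact: segment_compact.
have mD : measurable D by exact: measurable_itv.
have [N [h [ch h0 h1 hD hsupp]]] := @compact_partition_of_unity R R^o D t Dc t0.
have mh i : measurable_fun [set: R] (h i : R -> R) by apply: continuous_measurable_fun; exact: ch.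
have h01 i x : 0 <= h i x <= 1.
  rewrite h0/=; apply: le_trans (h1 x); rewrite (bigD1 i)//= lerDl.
  exact: sumr_ge0.
(* A measurable function of theta that controls both divergences; it stands in for [UOT] wherever
   measurability matters. *)
pose G n theta := \sum_(i < N) `|ridge_mass (alpha_ n) (h i) theta - ridge_mass alpha (h i) theta|.
have mG n : measurable_fun [set: Rd R d] (G n).
  apply: measurable_sum => i; apply: measurableT_comp => //.
  by apply: measurable_funB; exact: measurable_ridge_mass.
have G0 n theta : 0 <= G n theta by exact: sumr_ge0.
have cG theta : G n theta @[n --> \oo] --> 0.
  have -> : 0 = \sum_(i < N) `|ridge_mass alpha (h i) theta - ridge_mass alpha (h i) theta|.
    by rewrite big1// => i _; rewrite subrr normr0.
  apply: cvg_sumr => i; apply: cvg_norm; apply: cvgB; last exact: cvg_cst.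
  apply: fine_integral_cvg => x.
  exact: (cvg_comp _ _ (@continuous_dotv R d theta x) (@ch i _)).
(* The masses of [alpha_ n] converge and are therefore bounded, which gives the constant
   majorant. *)
have [B B0 GB] : exists2 B, 0 <= B & forall n theta, G n theta <= B.
  have : cvgn (fun n => fine (\int[alpha_ n]_x (cst 1 x)%:E)%E).
    by apply/cvg_ex; eexists; apply: (@fine_integral_cvg (cst 1)) => x; exact: cst_continuous.
  move=> /cvg_seq_bounded[A [_ AP]].
  have mA n : fine (alpha_ n setT) <= `|A| + 1.
    have <- : (\int[alpha_ n]_x (cst 1%R x)%:E)%E = alpha_ n setT.
      by have := integral_cst (alpha_ n) measurableT 1%E; rewrite mul1e.
    apply: le_trans (ler_norm _) _; apply: (AP (`|A| + 1)) => //.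
    by rewrite (le_lt_trans (ler_norm _))// ltrDl.
  exists (\sum_(i < N) (`|A| + 1 + m)) => [|n theta].
    by apply: sumr_ge0 => i _; rewrite !addr_ge0.
  apply: ler_sum => i _; apply: (le_trans (ler_normB _ _)).
  have /andP[a1 a2] := ridge_mass_le theta (fin_ n) (mh i) (h01 i).
  have /andP[b1 b2] := ridge_mass_le theta fin (mh i) (h01 i).
  by rewrite (ger0_norm a1) (ger0_norm b1) lerD// (le_trans a2).
have [sT _ _] := hsigma.
have sfin : (sigma setT < +oo)%E by rewrite sT ltry.
have IG : (\int[sigma]_theta (G n theta)%:E)%E @[n --> \oo] --> 0%E.
  have mGE n : measurable_fun [set: Rd R d] (fun theta => (G n theta)%:E) by exact/measurable_EFinP.
  have aeG : {ae sigma, forall theta, [set: Rd R d] theta ->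
      (fun n => (G n theta)%:E) @ \oo --> (cst 0%E theta : \bar R)}.
    by apply: aeW => theta _; apply: cvg_EFin; [near=> n|exact: cG].
  have iB : sigma.-integrable [set: Rd R d] (cst B%:E).
    apply/integrableP; split; first exact: measurable_cst.
    by rewrite /= integral_cst// sT mule1 ltry.
  have aeB : {ae sigma, forall theta n, [set: Rd R d] theta ->
      (`|(G n theta)%:E| <= cst B%:E theta)%E}.
    by apply: aeW => theta n _ /=; rewrite lee_fin ger0_norm.
  have [_ _] := dominated_convergence measurableT mGE (measurable_cst _) aeG iB aeB.
  by rewrite integral0.
have c0 : (0 < (e / 4 / rho)%:E)%E by rewrite lte_fin !divr_gt0.
have IGs := ecvg0_lt IG c0.
have key n theta : S theta ->
  (UOT p rho (pushforward (alpha_ n) (proj_theta theta)) (pushforward alpha (proj_theta theta))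
   <= (e / 2)%:E + (2 * rho)%:E * (G n theta)%:E)%E.
  move=> Sth; have mth := measurable_proj_theta theta.
  have [a aE] := pushforward_measure (alpha_ n) mth.
  have [b bE] := pushforward_measure alpha mth.
  have DX (mu : {measure set (Rd R d) -> \bar R}) : mu (~` X) = 0%E ->
      pushforward mu (proj_theta theta) (~` D) = 0%E.
    move=> mu0; apply/eqP; rewrite /pushforward eq_le measure_ge0 andbT -mu0.
    have mX : measurable (X : set (Rd R d)) := compact_measurable_Rd Xc.
    apply: le_measure.
    - by apply/mem_set; rewrite -[X in measurable X]setTI; apply: mth => //; exact: measurableC.
    - by apply/mem_set; exact: measurableC.
    move=> x /= nD Xx; apply: nD; rewrite /D /= in_itv /= -ler_norml.
    by apply: (le_trans (norm_proj _ Sth)); rewrite ler_wpM2l// XC.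
  have pT (mu : {measure set (Rd R d) -> \bar R}) :
      pushforward mu (proj_theta theta) setT = mu setT.
    by rewrite /pushforward preimage_setT.
  have cv (mu : {measure set (Rd R d) -> \bar R}) i :
      (\int[pushforward mu (proj_theta theta)]_x (h i x)%:E = \int[mu]_x (h i (dotv theta x))%:E)%E.
    rewrite (ge0_integral_pushforward mth mu measurableT)//; first exact/measurable_EFinP.
    by move=> x _; rewrite lee_fin.
  have afin : (a setT < +oo)%E by rewrite aE pT.
  have bfin : (b setT < +oo)%E by rewrite bE pT.
  have aD : a (~` D) = 0%E by rewrite aE; exact: DX (ha_ n).2.
  have bD : b (~` D) = 0%E by rewrite bE; exact: DX ha.2.
  have [pi [K1 K2 Kc]] := partition_coupling (T := R) (ltW rho0) mh h0 h1 mD hD afin bfin aD bD.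
  rewrite -aE -bE.
  apply: ge_ereal_inf; exists (\int[pi]_z (cost1 p z)%:E + KLdiv rho (pushforward pi fst) a
    + KLdiv rho (pushforward pi snd) b)%E; first by exists pi.
  have GE : ((2 * rho)%:E * (G n theta)%:E = (rho * G n theta)%:E + (rho * G n theta)%:E)%E.
    by rewrite -EFinM -EFinD; congr (_%:E); ring.
  have SE : \sum_(i < N)
      `|fine (\int[a]_x (h i x)%:E)%E - fine (\int[b]_x (h i x)%:E)%E| = G n theta.
    by apply: eq_bigr => i _; rewrite aE bE !cv.
  rewrite GE addeA; rewrite SE in K1 K2.
  apply: leeD => //; apply: leeD => //.
  apply: (@le_trans _ _ ((t `^ p)%:E * b setT)%E); last by rewrite bE pT mE -EFinM lee_fin.
  apply: Kc => [|z||i x y hx hy]; [exact: measurable_cost1|exact: cost1_ge0|exact: powR_ge0|].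
  rewrite /cost1 /=; apply: (ge0_ler_powR p0) => //; rewrite ?nnegrE ?(ltW t0)//.
  exact: hsupp hx hy.
near=> n.
have In : (\int[sigma]_theta (G n theta)%:E < (e / 4 / rho)%:E)%E by near: n; exact: IGs.
have mEG : measurable_fun [set: Rd R d] (fun theta => (G n theta)%:E) by exact/measurable_EFinP.
have r2 : (0 <= (2 * rho)%:E)%E by rewrite lee_fin mulr_ge0// ltW.
apply: (@le_trans _ _ (\int[sigma]_theta ((e / 2)%:E + (2 * rho)%:E * (G n theta)%:E))%E).
  apply: lower_integral_sphere_le.
  - by move=> theta; apply: UOT_proj_ge0; exact: ltW.
  - by move=> theta; rewrite adde_ge0// ?mule_ge0// lee_fin// ltW.
  - by apply: emeasurable_funD => //; exact: measurable_funeM.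
  - by move=> theta; exact: key.
rewrite ge0_integralD//; last 3 first.
- by move=> theta _; rewrite lee_fin ltW.
- by move=> theta _; rewrite mule_ge0// lee_fin.
- exact: measurable_funeM.
rewrite integral_cst// sT mule1 ge0_integralZl//; last by move=> theta _; rewrite lee_fin.
apply: (@le_trans _ _ ((e / 2)%:E + (2 * rho)%:E * (e / 4 / rho)%:E)%E).
  by rewrite leeD2l// lee_wpmul2l// ltW.
rewrite -EFinM -EFinD lee_fin.
have -> : 2 * rho * (e / 4 / rho) = e / 2 by field; rewrite gt_eqF.
by lra.
Unshelve. all: by end_near. Qed.

End weak_to_sliced.

(** * Weak convergence from vanishing sliced costs *)

Section sliced_to_weak.
Context (R : realType) (d : nat) (hd : (0 < d)%N).
Variables (sigma : {measure set (Rd R d) -> \bar R}) (rho p : R).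
Hypotheses (hsigma : uniform_sphere sigma) (rho0 : 0 < rho) (p1 : 1 <= p).
Variable X : set 'rV[R]_d.
Hypothesis Xc : compact X.
Variables (alpha_ : nat -> {measure set (Rd R d) -> \bar R})
  (alpha : {measure set (Rd R d) -> \bar R}).
Hypotheses (ha_ : forall n, radon_in X (alpha_ n)) (ha : radon_in X alpha).

Let fin : (alpha setT < +oo)%E := radon_in_finite Xc ha.

Lemma SUOT_weak : (fun n => SUOT sigma p rho (alpha_ n) alpha) @ \oo --> 0%E ->
  weak_cvg alpha_ alpha.
Proof.
move=> S0; apply: (ridge_weak_cvg hd Xc ha_ ha) => theta0 th0 B L r e B0 L0 r0 e0.
have [c c0 cP] := SUOT_ridge hsigma rho0 p1 fin th0 B0 L0 r0 e0.
by near=> n; apply: cP; near: n; exact: ecvg0_lt.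
Unshelve. all: by end_near. Qed.

Lemma USOT_weak : (fun n => USOT sigma p rho (alpha_ n) alpha) @ \oo --> 0%E ->
  weak_cvg alpha_ alpha.
Proof.
move=> S0; apply: (ridge_weak_cvg hd Xc ha_ ha) => theta0 th0 B L r e B0 L0 r0 e0.
have [c c0 cP] := USOT_ridge hsigma rho0 p1 fin th0 B0 L0 r0 e0.
by near=> n; apply: cP; near: n; exact: ecvg0_lt.
Unshelve. all: by end_near. Qed.

End sliced_to_weak.
Theorem theorem2 (R : realType) (d : nat) (hd : (0 < d)%N)
    (sigma : {measure set (Rd R d) -> \bar R}) (hsigma : uniform_sphere sigma)
    (rho : R) (hrho : 0 < rho) (p : R) (hp : 1 <= p)
    (X : set 'rV[R]_d) (hX : compact X) (Rad : R) (hRad : 0 < Rad)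
    (hXR : X `<=` [set x | enorm x <= Rad])
    (alpha_ : nat -> {measure set (Rd R d) -> \bar R})
    (halpha_ : forall n, radon_in X (alpha_ n))
    (alpha : {measure set (Rd R d) -> \bar R}) (halpha : radon_in X alpha) :
  (weak_cvg alpha_ alpha <->
     (fun n => SUOT sigma p rho (alpha_ n) alpha) @ \oo --> 0%E) /\
  ((fun n => SUOT sigma p rho (alpha_ n) alpha) @ \oo --> 0%E <->
     (fun n => USOT sigma p rho (alpha_ n) alpha) @ \oo --> 0%E).
Proof.
have weakS := weak_SUOT hsigma hrho hp hX halpha_ halpha.
have weakU := weak_USOT hsigma hrho hp hX halpha_ halpha.
have Sweak := SUOT_weak hd hsigma hrho hp hX halpha_ halpha.
have Uweak := USOT_weak hd hsigma hrho hp hX halpha_ halpha.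
by (split; split); [exact: weakS|exact: Sweak|move=> /Sweak/weakU|move=> /Uweak/weakS].
Qed.
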